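(* Let $d\in\mathbb{N}$ and $n\in\mathbb{N}$. (i) Let $s>1/2$. Then $$a_n(I_d:H^{s,*}_{\rm mix}(\mathbb{T}^d)\to L_2(\mathbb{T}^d))\le2^{-d/2}\Big[\frac{6^d}{(d-1)!}\Big]^s\frac{(\ln n)^{(d-1)s}}{n^s}\qquad\text{if } n\ge27^d,$$ and $$a_n(I_d:H^{s,*}_{\rm mix}(\mathbb{T}^d)\to L_2(\mathbb{T}^d))\ge\Big[\frac{3\cdot2^d}{d!\,(2+\ln12)^d}\Big]^s\frac{(\ln n)^{(d-1)s}}{n^s}\qquad\text{if } n>(12\,e^2)^d .$$ (ii) Let $0<s\le1/2$. Then $$a_n(I_d:H^{s,*}_{\rm mix}(\mathbb{T}^d)\to L_2(\mathbb{T}^d))\le\Big[\frac{3^d}{(d-1)!}\Big]^s\frac{(\ln n)^{(d-1)s}}{n^s}\qquad\text{if } n\ge27^d,$$ and $$a_n(I_d:H^{s,*}_{\rm mix}(\mathbb{T}^d)\to L_2(\mathbb{T}^d))\ge2^{-d/2}\Big[\frac{3\cdot4^d}{d!\,(2+\ln12)^d}\Big]^s\frac{(\ln n)^{(d-1)s}}{n^s}\qquad\text{if } n>(12\,e^2)^d .$$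
   Context: $\mathbb{N}=\{1,2,3,\dots\}$. $\mathbb{T}^d$ is the $d$-torus, represented by $[0,2\pi]^d$ with opposite sides identified. $L_2(\mathbb{T}^d)$ carries the norm $\|f|L_2(\mathbb{T}^d)\|=(\int_{\mathbb{T}^d}|f(x)|^2dx)^{1/2}$, and for $f\in L_2(\mathbb{T}^d)$ the Fourier coefficients are $c_k(f)=(2\pi)^{-d/2}\int_{\mathbb{T}^d}f(x)e^{-ikx}dx$, $k\in\mathbb{Z}^d$ (so $\|f|L_2(\mathbb{T}^d)\|^2=\sum_k|c_k(f)|^2$). For $s>0$, $H^{s,*}_{\rm mix}(\mathbb{T}^d)$ is the space of all $f\in L_2(\mathbb{T}^d)$ for which the norm $$\|f|H^s_{\rm mix}(\mathbb{T}^d)\|^{*}=\Big[\sum_{k\in\mathbb{Z}^d}|c_k(f)|^2\prod_{j=1}^d(1+|k_j|^{2s})\Big]^{1/2}$$ is finite, equipped with this norm. $I_d$ denotes the identical embedding $f\mapsto f$. The approximation numbers of a bounded linear operator $T:X\to Y$ between Banach spaces are $a_n(T:X\to Y)=\inf\{\|T-A:X\to Y\| : A:X\to Y \text{ bounded linear},\ {\rm rank}\,A<n\}$, $n\in\mathbb{N}$. *)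

(* Defs.v *)
From HB Require Import structures.
From mathcomp Require Import all_boot all_order all_algebra.
From mathcomp Require Import all_classical all_reals all_analysis.
From mathcomp Require Import measurable_realfun.
From mathcomp Require Import complex ring.

Set Implicit Arguments.
Unset Strict Implicit.
Unset Printing Implicit Defensive.

Import Order.TTheory GRing.Theory Num.Theory.
Import numFieldNormedType.Exports.

Local Open Scope classical_set_scope.
Local Open Scope ring_scope.
Local Open Scope complex_scope.
Local Open Scope quotient_scope.

Section tuple_measure.
Context d (T : measurableType d) (R : realType).

Definition cons_pair n (p : T * n.-tuple T) : n.+1.-tuple T :=
  [tuple of p.1 :: p.2].

Lemma measurable_cons_pair n :
  measurable_fun [set: T * n.-tuple T] (@cons_pair n).
Proof. exact: measurable_cons. Qed.

Section cons_measure.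
Variables (n : nat) (m1 : {finite_measure set T -> \bar R}).
Variable m2 : {finite_measure set (n.-tuple T) -> \bar R}.

Definition cons_measure : set (n.+1.-tuple T) -> \bar R :=
  pushforward (m1 \x m2)%E (@cons_pair n).

Let cons_measureE : {measure set (n.+1.-tuple T) -> \bar R} :=
  measure_function_pushforward__canonical__measure_function_Measure
    (m1 \x m2)%E (@measurable_cons_pair n).

HB.instance Definition _ := isMeasure.Build _ _ _ cons_measure
  (measure0 cons_measureE) (measure_ge0 cons_measureE)
  (@measure_semi_sigma_additive _ _ _ cons_measureE).

Let cons_measure_fin : fin_num_fun cons_measure.
Proof.
apply: lty_fin_num_fun.
change ((m1 \x m2)%E (@cons_pair n @^-1` setT) < +oo)%E.
rewrite preimage_setT -setXTT product_measure1E//.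
by rewrite lte_mul_pinfty// ?fin_num_measure// ltey_eq fin_num_measure.
Qed.

HB.instance Definition _ :=
  Measure_isFinite.Build _ _ _ cons_measure cons_measure_fin.

End cons_measure.

(* The n-fold product of mu with itself. *)
Fixpoint tuple_measure (mu : {finite_measure set T -> \bar R}) n :
    {finite_measure set (n.-tuple T) -> \bar R} :=
  if n is n'.+1 then cons_measure mu (tuple_measure mu n')
  else \d_([tuple] : 0.-tuple T).

End tuple_measure.

Section complex_L2.
Context d (T : measurableType d) (R : realType).
Variable mu : {measure set T -> \bar R}.

Definition L2_pred : {pred T -> R[i]} := [pred f : T -> R[i] |
  ((fun x => complex.Re (f x)) \in Lfun mu 2%:E) &&
  ((fun x => complex.Im (f x)) \in Lfun mu 2%:E)].

Let Lfun2_lin (a b : R) (f g h : T -> R) :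
  f \in Lfun mu 2%:E -> g \in Lfun mu 2%:E -> h \in Lfun mu 2%:E ->
  (fun x => a * f x + b * g x + h x) \in Lfun mu 2%:E.
Proof.
have /GRing.subsemimod_closedD[L0 LD] := Lfun_submod_closed mu (lee1n 2).
have [_ LZ] := Lfun_submod_closed mu (lee1n 2).
move=> fL gL hL.
have -> : (fun x => a * f x + b * g x + h x) = a *: f + (b *: g + h).
  by apply/funext => x; rewrite !fctE -addrA.
exact/LZ/LZ.
Qed.

Lemma L2_pred_submod_closed : submod_closed L2_pred.
Proof.
split=> [|a f g /andP[fr fi] /andP[gr gi]].
  have [L0 _] := Lfun_submod_closed mu (lee1n 2).
  by apply/andP; split; exact: L0.
apply/andP; split.
  suff -> : (fun x => complex.Re ((a *: f + g) x)) = fun x =>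
      complex.Re a * complex.Re (f x) + - complex.Im a * complex.Im (f x)
      + complex.Re (g x) by exact: Lfun2_lin.
  apply/funext => x; rewrite !fctE.
  by case: a (f x) (g x) => [a1 a2] [f1 f2] [g1 g2] /=; rewrite mulNr.
suff -> : (fun x => complex.Im ((a *: f + g) x)) = fun x =>
    complex.Re a * complex.Im (f x) + complex.Im a * complex.Re (f x)
    + complex.Im (g x) by exact: Lfun2_lin.
apply/funext => x; rewrite !fctE.
by case: a (f x) (g x) => [a1 a2] [f1 f2] [g1 g2] /=.
Qed.

HB.instance Definition _ :=
  GRing.isSubmodClosed.Build _ _ L2_pred L2_pred_submod_closed.

Record L2_fun := { L2_val :> T -> R[i]; _ : L2_val \in L2_pred }.

HB.instance Definition _ := [isSub for L2_val].
HB.instance Definition _ := [Choice of L2_fun by <:].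
HB.instance Definition _ := [SubChoice_isSubLmodule of L2_fun by <:].

Definition L2_null : {pred L2_fun} :=
  fun f => `[< \forall x \ae mu, f x = 0 >].

Lemma L2_null_submod_closed : submod_closed L2_null.
Proof.
split=> [|a f g /asboolP f0 /asboolP g0]; apply/asboolP.
  exact: nearW.
by apply: filterS2 f0 g0 => x /= fx gx; rewrite !fctE fx gx scaler0 addr0.
Qed.

HB.instance Definition _ :=
  GRing.isSubmodClosed.Build _ _ L2_null L2_null_submod_closed.

(* Classes of square-integrable functions T -> R[i] modulo equality mu-a.e. *)
Definition L2 : Type := Quotient.quot L2_null.
HB.instance Definition _ := GRing.Zmodule.on L2.
HB.instance Definition _ := EqQuotient.on L2.

Definition L2_scale (a : R[i]) (f : L2) : L2 := \pi_L2 (a *: repr f).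


Lemma pi_L2D (f g : L2_fun) : \pi_L2 (f + g) = \pi_L2 f + \pi_L2 g.
Proof. exact: (raddfD (\pi_(Quotient.quot L2_null))). Qed.

Lemma pi_L2P (f g : L2_fun) :
  reflect (\forall x \ae mu, f x = g x) (\pi_L2 f == \pi_L2 g).
Proof.
rewrite -(@Quotient.idealrBE _ L2_null) unfold_in.
apply: (iffP (asboolP _)); apply: filterS => x.
  by move=> /eqP; rewrite subr_eq0 => /eqP.
by move=> fg; apply/eqP; rewrite subr_eq0; apply/eqP.
Qed.

Lemma pi_L2_scale a (f : L2_fun) : \pi_L2 (a *: f) = L2_scale a (\pi_L2 f).
Proof.
apply/esym/eqP/pi_L2P.
have /eqP/pi_L2P : \pi_L2 (repr (\pi_L2 f)) = \pi_L2 f by rewrite reprK.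
by apply: filterS => x E; congr (a * _).
Qed.

Let L2_scaleA a b f : L2_scale a (L2_scale b f) = L2_scale (a * b) f.
Proof.
elim/quotW: f => f.
by rewrite -(pi_L2_scale b) -(pi_L2_scale a) -pi_L2_scale scalerA.
Qed.

Let L2_scale1 : left_id 1 L2_scale.
Proof. by elim/quotW => f; rewrite -(pi_L2_scale 1) scale1r. Qed.

Let L2_scaleDr : right_distributive L2_scale +%R.
Proof.
move=> a; elim/quotW => f; elim/quotW => g.
by rewrite -pi_L2D -!(pi_L2_scale a) -pi_L2D scalerDr.
Qed.

Let L2_scaleDl f : {morph L2_scale^~ f : a b / a + b}.
Proof.
elim/quotW: f => f a b.
by rewrite -(pi_L2_scale a) -(pi_L2_scale b) -pi_L2_scale -pi_L2D scalerDl.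
Qed.

HB.instance Definition _ :=
  GRing.Zmodule_isLmodule.Build _ L2
    L2_scaleA L2_scale1 L2_scaleDr L2_scaleDl.

Lemma repr_L2_lin a (f g : L2) :
  \forall x \ae mu, repr (a *: f + g) x = a * repr f x + repr g x.
Proof.
have /eqP/pi_L2P // : \pi_L2 (repr (a *: f + g)) = \pi_L2 (a *: repr f + repr g).
by rewrite reprK pi_L2D pi_L2_scale !reprK.
Qed.

Definition L2_norm (f : L2) : R :=
  Num.sqrt (fine (\int[mu]_x (Normc.normc (repr f x) ^+ 2)%:E)).

End complex_L2.

Section complex_integral.
Context d (T : measurableType d) (R : realType).
Variable mu : {measure set T -> \bar R}.
Implicit Types u v : T -> R[i].

Definition cintegral u : R[i] :=
  (\int[mu]_x complex.Re (u x)) +i* (\int[mu]_x complex.Im (u x)).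

Definition cintegrable u :=
  mu.-integrable setT (fun x => (complex.Re (u x))%:E) /\
  mu.-integrable setT (fun x => (complex.Im (u x))%:E).

Lemma integrable_lin (a b : R) (f g h : T -> R) :
    mu.-integrable setT (EFin \o f) -> mu.-integrable setT (EFin \o g) ->
    mu.-integrable setT (EFin \o h) ->
  mu.-integrable setT (EFin \o (fun x => a * f x + b * g x + h x)) /\
  (\int[mu]_x (a * f x + b * g x + h x) =
    a * (\int[mu]_x f x) + b * (\int[mu]_x g x) + \int[mu]_x h x).
Proof.
move=> fi gi hi.
have afi : mu.-integrable setT (EFin \o (fun x => a * f x)).
  exact: (integrableZl measurableT a fi).
have bgi : mu.-integrable setT (EFin \o (fun x => b * g x)).
  exact: (integrableZl measurableT b gi).
have abi : mu.-integrable setT (EFin \o (fun x => a * f x + b * g x)).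
  exact: (integrableD measurableT afi bgi).
split; first exact: (integrableD measurableT abi hi).
rewrite RintegralD// RintegralD// RintegralZl// RintegralZl//.
Qed.

Lemma cintegral_lin a u v : cintegrable u -> cintegrable v ->
  cintegral (fun x => a * u x + v x) = a * cintegral u + cintegral v.
Proof.
move=> [ur ui] [vr vi]; rewrite /cintegral.
have [_ Er] := integrable_lin (complex.Re a) (- complex.Im a) ur ui vr.
have [_ Ei] := integrable_lin (complex.Re a) (complex.Im a) ui ur vi.
case: a Er Ei => a1 a2 /= Er Ei; congr Complex.
- rewrite -mulNr -Er; apply: eq_Rintegral => x _.
  by case: (u x) (v x) => [? ?] [? ?] /=; rewrite mulNr.
- rewrite -Ei; apply: eq_Rintegral => x _.
  by case: (u x) (v x) => [? ?] [? ?] /=.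
Qed.

End complex_integral.

(* The torus T^d is represented by the cube [0, 2 pi]^d: torus_measure is the
   d-fold product of the Lebesgue measure restricted to [0, 2 pi], hence the
   Lebesgue measure on R^d restricted to the cube. As L2 is taken modulo
   equality almost everywhere, values outside the cube are irrelevant and no
   periodicity condition is needed. *)
Section torus.
Variables (R : realType) (d : nat).

Lemma lebesgue_measure_0_2pi_lty :
  (@lebesgue_measure R `[0%R, (2 * pi)%R]%classic < +oo)%E.
Proof. by rewrite lebesgue_measure_itv; case: ifP => // _; rewrite -EFinB ltry. Qed.

Definition circle_measure : {finite_measure set (measurableTypeR R) -> \bar R} :=
  @mfrestr _ (measurableTypeR R) R _ lebesgue_measure
    (measurable_itv `[0, 2 * pi]) lebesgue_measure_0_2pi_lty.

Definition torus_measure :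
    {finite_measure set (d.-tuple (measurableTypeR R)) -> \bar R} :=
  tuple_measure circle_measure d.

Definition torus_L2 : Type := L2 torus_measure.
HB.instance Definition _ := GRing.Lmodule.on torus_L2.

Definition dotk (k : d.-tuple int) (x : d.-tuple R) : R :=
  \sum_(j < d) (tnth k j)%:~R * tnth x j.

Definition cis (t : R) : R[i] := cos t +i* sin t.

Definition fourier_coef (f : torus_L2) (k : d.-tuple int) : R[i] :=
  ((2 * pi) `^ (- (d%:R / 2)))%:C *
  cintegral torus_measure (fun x => repr f x * cis (- dotk k x)).

Let measurable_dotk k :
  measurable_fun [set: d.-tuple (measurableTypeR R)] (fun x => - dotk k x : R).
Proof.
apply: measurableT_comp => //; apply: measurable_sum => j.
by apply: measurable_funM => //; exact: measurable_tnth.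
Qed.

Let integrable_bounded (u h : d.-tuple (measurableTypeR R) -> R) :
  u \in Lfun torus_measure 2%:E -> measurable_fun setT h ->
  (forall x, `|h x| <= 1) ->
  torus_measure.-integrable setT (EFin \o (fun x => u x * h x)).
Proof.
move=> uL mh h1; apply: (@integrableMl _ _ _ _ _ _ (EFin \o u) h) => //.
  apply/Lfun1_integrable/Lfun_subset12 => //.
  exact: fin_num_measure.
exists 1; split=> // M M1 x _; exact: le_trans (h1 x) (ltW M1).
Qed.

Let cintegrable_fourier (f : L2_fun torus_measure) k :
  cintegrable torus_measure (fun x => f x * cis (- dotk k x)).
Proof.
have mc : measurable_fun [set: d.-tuple (measurableTypeR R)]
    (fun x => cos (- dotk k x)).
  apply: measurableT_comp (measurable_dotk k); apply: continuous_measurable_fun.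
  exact: continuous_cos.
have ms : measurable_fun [set: d.-tuple (measurableTypeR R)]
    (fun x => sin (- dotk k x)).
  apply: measurableT_comp (measurable_dotk k); apply: continuous_measurable_fun.
  exact: continuous_sin.
have c1 x : `|cos (- dotk k x)| <= 1 by rewrite ler_norml cos_geN1 cos_le1.
have s1 x : `|sin (- dotk k x)| <= 1 by rewrite ler_norml sin_geN1 sin_le1.
case: f => f /= /andP[fr fi]; split.
  have := integrableB measurableT
    (integrable_bounded fr mc c1) (integrable_bounded fi ms s1).
  apply: eq_integrable => // x _ /=.
  by case: (f x) => a b /=; rewrite EFinB.
have := integrableD measurableT
  (integrable_bounded fr ms s1) (integrable_bounded fi mc c1).
apply: eq_integrable => // x _ /=.
by case: (f x) => a b /=; rewrite EFinD.
Qed.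

Lemma cintegral_ae (u v : d.-tuple (measurableTypeR R) -> R[i]) :
  cintegrable torus_measure u -> cintegrable torus_measure v ->
  (\forall x \ae torus_measure, u x = v x) ->
  cintegral torus_measure u = cintegral torus_measure v.
Proof.
move=> [ur ui] [vr vi] uv; rewrite /cintegral; congr Complex; congr fine.
  apply: ae_eq_integral => //; [exact: measurable_int ur|exact: measurable_int vr|].
  by apply: filterS uv => x -> _.
apply: ae_eq_integral => //; [exact: measurable_int ui|exact: measurable_int vi|].
by apply: filterS uv => x -> _.
Qed.

Lemma fourier_coef_lin a (f g : torus_L2) k :
  fourier_coef (a *: f + g) k = a * fourier_coef f k + fourier_coef g k.
Proof.
rewrite /fourier_coef mulrCA -mulrDr; congr (_ * _).
pose h (u : torus_L2) x := repr u x * cis (- dotk k x).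
have E : (fun x => (a *: repr f + repr g : L2_fun _) x * cis (- dotk k x)) =
         (fun x => a * h f x + h g x).
  by apply/funext => x; rewrite /h mulrA -mulrDl.
rewrite -(cintegral_lin a (cintegrable_fourier (repr f) k)
  (cintegrable_fourier (repr g) k)) -[in RHS]E.
apply: cintegral_ae; [exact: cintegrable_fourier|exact: cintegrable_fourier|].
by apply: filterS (repr_L2_lin a f g) => x ->.
Qed.

Definition mix_weight (s : R) (k : d.-tuple int) : R :=
  \prod_(j < d) (1 + `|(tnth k j)%:~R| `^ (2 * s)).

Definition mix_sqnorm (s : R) (f : torus_L2) : \bar R :=
  \esum_(k in [set: d.-tuple int])
    (Normc.normc (fourier_coef f k) ^+ 2 * mix_weight s k)%:E.

Definition Hmix_pred (s : R) : {pred torus_L2} :=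
  fun f => `[< (mix_sqnorm s f < +oo)%E >].

Let mix_weight_ge0 s k : 0 <= mix_weight s k.
Proof. by apply: prodr_ge0 => j _; rewrite addr_ge0 ?powR_ge0. Qed.

Let esumZ_le (c : R) (b : d.-tuple int -> R) : 0 <= c -> (forall k, 0 <= b k) ->
  (\esum_(k in setT) (c * b k)%:E <= c%:E * \esum_(k in setT) (b k)%:E)%E.
Proof.
move=> c0 b0; apply: ub_ereal_sup => _ [A [Afin AT] <-].
under eq_fsbigr do rewrite EFinM.
rewrite -ge0_mule_fsumr; last by move=> k; rewrite lee_fin.
apply: lee_pmul => //; first by apply: fsume_ge0 => k _; rewrite lee_fin.
by apply: ereal_sup_ubound; exists A.
Qed.

Lemma Hmix_pred_submod_closed s : submod_closed (Hmix_pred s).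
Proof.
have coef0 k : fourier_coef 0 k = 0.
  have := fourier_coef_lin 1 0 0 k; rewrite scaler0 addr0 mul1r => /esym/eqP.
  by rewrite -subr_eq0 addrK => /eqP.
split=> [|a f g /asboolP fs /asboolP gs]; apply/asboolP.
  rewrite /mix_sqnorm esum1// => k _.
  by rewrite coef0 Normc.normc0 expr0n/= mul0r.
pose c := 2 * Normc.normc a ^+ 2.
have c0 : 0 <= c by rewrite mulr_ge0 ?sqr_ge0.
pose b (u : torus_L2) k := Normc.normc (fourier_coef u k) ^+ 2 * mix_weight s k.
have b0 u k : 0 <= b u k by rewrite mulr_ge0 ?sqr_ge0.
apply: (@le_lt_trans _ _ (c%:E * mix_sqnorm s f + 2%:E * mix_sqnorm s g)%E);
  last by rewrite lte_add_pinfty ?lte_mul_pinfty.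
apply: le_trans (leeD (esumZ_le c0 (b0 f)) (esumZ_le (ler0n _ 2) (b0 g))).
rewrite -esumD; [|by move=> k _; rewrite lee_fin mulr_ge0..].
apply: le_esum => k _; rewrite -EFinD lee_fin /b !mulrA -mulrDl.
apply: ler_wpM2r => //; rewrite fourier_coef_lin /c.
set x := fourier_coef f k; set y := fourier_coef g k.
have h : Normc.normc (a * x + y) <= Normc.normc a * Normc.normc x + Normc.normc y.
  by rewrite -Normc.normcM; exact: le_normcD.
have n0 (z : R[i]) : 0 <= Normc.normc z by case: z => ? ?; exact: sqrtr_ge0.
apply: le_trans (_ : (Normc.normc a * Normc.normc x + Normc.normc y) ^+ 2 <= _).
  by rewrite ler_sqr ?nnegrE// ?addr_ge0 ?mulr_ge0.
move: (Normc.normc a) (Normc.normc x) (Normc.normc y) => p q r.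
rewrite -subr_ge0 (_ : _ - _ = (p * q - r) ^+ 2) ?sqr_ge0//.
by ring.
Qed.

HB.instance Definition _ s := GRing.isSubmodClosed.Build _ _ (Hmix_pred s)
  (Hmix_pred_submod_closed s).

Record Hmix (s : R) := { Hmix_val : torus_L2; _ : Hmix_val \in Hmix_pred s }.

HB.instance Definition _ s := [isSub for @Hmix_val s].
HB.instance Definition _ s := [Choice of Hmix s by <:].
HB.instance Definition _ s := [SubChoice_isSubLmodule of Hmix s by <:].

Definition Hmix_norm (s : R) (f : Hmix s) : R :=
  Num.sqrt (fine (mix_sqnorm s (Hmix_val f))).

Definition Hmix_embedding (s : R) (f : Hmix s) : torus_L2 := Hmix_val f.

HB.instance Definition _ s := GRing.Linear.copy (@Hmix_embedding s)
  (\val : {linear Hmix s -> torus_L2}).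

End torus.

(* Norms are passed as real-valued functions on complex vector spaces, not as
   normedModType structures: that the norm of Hmix is definite is the
   completeness of the trigonometric system. The numbers are extended reals, so
   that infima and suprema have no junk values. *)
Section approximation_numbers.
Variables (R : realType) (X Y : lmodType R[i]).
Variables (normX : X -> R) (normY : Y -> R).

Definition opnorm (T : X -> Y) : \bar R :=
  ereal_sup [set (normY (T x))%:E | x in [set x | normX x <= 1]].

Definition bounded_op (T : X -> Y) : Prop :=
  exists M : R, forall x, normY (T x) <= M * normX x.

Definition has_rank (T : X -> Y) (r : nat) : Prop :=
  exists e : 'I_r -> Y,
    (forall c : 'I_r -> R[i], \sum_i c i *: e i = 0 -> forall i, c i = 0) /\
    range T = [set \sum_i c i *: e i | c in [set: 'I_r -> R[i]]].

Definition approx_number (n : nat) (T : {linear X -> Y}) : \bar R :=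
  ereal_inf [set opnorm (fun x => T x - A x) | A in
    [set A : {linear X -> Y} |
      bounded_op A /\ exists2 r, (r < n)%N & has_rank A r]].

End approximation_numbers.

Definition mix_approx_number (R : realType) (d : nat) (s : R) (n : nat) : \bar R :=
  approx_number (@Hmix_norm R d s) (@L2_norm _ _ _ (torus_measure R d)) n
    (@Hmix_embedding R d s).

(* Main.v *)
From HB Require Import structures.
Require Import Defs.
From mathcomp Require Import all_boot all_order all_algebra.
From mathcomp Require Import all_classical all_reals all_analysis.
From mathcomp Require Import measurable_realfun complex zify ring lra.

(* In the orthonormal basis e_k of exponentials the embedding is diagonal, with singular
   values mix_weight s k ^ (-1/2). Projecting onto finitely many e_k bounds a_n from
   above, since Parseval controls the remainder; restricting to the span of n basis
   vectors, on which any operator of rank < n has a kernel, bounds it from below. By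
   convexity of x |-> x^p for p = 2s, the weight is comparable with h(k)^(2s), where
   h(k) = prod_j (1 + |k_j|), up to a factor 2^(d|1 - 2s|) on one side only, which side
   depending on whether s > 1/2. It remains to bound the number of k with h(k) <= r on
   both sides by an explicit multiple of r (ln r)^(d-1) / (d-1)!, by induction on d:
   fixing one coordinate gives a sum of terms (1/m) ln(r/m)^(d-1), which telescopes
   because ln((m+1)/m) is about 1/m.
   Parseval follows from the density of trigonometric polynomials: explicit
   trigonometric polynomials converge boundedly almost everywhere to indicators of boxes,
   and boxes form a generating pi-system. *)

Set Implicit Arguments.
Unset Strict Implicit.
Unset Printing Implicit Defensive.

Import Order.TTheory GRing.Theory Num.Theory.
Import numFieldNormedType.Exports.

Local Open Scope classical_set_scope.
Local Open Scope ring_scope.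
Local Open Scope complex_scope.
Local Open Scope quotient_scope.

(** * Hyperbolic crosses *)

(** The counting estimates use a real radius [r]: fixing a coordinate with [|z| + 1 = m] replaces
    [r] by [r / m], and it is the real quotient whose logarithms telescope; the integer [M] enters
    through [M <= r] or [r < M + 1]. The radii [upper_radius] and [lower_radius] are the values of
    [r] for which [r ^ (- s)], up to the power of 2 lost in comparing the weights, is exactly the
    asserted rate. What remains is that the cross of the first radius has fewer than [n] points and
    that of the second at least [n]. The hypotheses on [n] serve there: [27 ^ d <= n] gives
    [d <= ln n], and [n > (12 e^2)^d] says that [ln n > d (2 + ln 12)], the constant of the lower
    bounds being [ln (12 e^2)]. Completeness of the exponentials enters through the upper bound,
    where the part of [f] outside the cross has to be measured; the lower bound lives on finite
    combinations of exponentials. *)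

Definition hweight d (k : d.-tuple int) : nat := \prod_(j < d) `|tnth k j|.+1.

(** Positive and negative integers are listed separately so that the layers [z] and [- z] of a cross
    can be paired; [Negz i] is [- (i + 1)]. *)
Definition zrange (M : nat) : seq int :=
  if M is M'.+1 then
    0 :: [seq i.+1%:Z | i <- iota 0 M'] ++ [seq Negz i | i <- iota 0 M']
  else [::].

(** Once the first coordinate is [z], the others must have weight at most [M / (|z| + 1)], and for
    integer weights this quotient may be rounded down. In dimension 0 the weight is the empty
    product 1, hence the test [0 < M]. *)
Fixpoint hcross (d M : nat) : seq (d.-tuple int) :=
  if d is d'.+1 then
    [seq [tuple of z :: k] | z : int <- zrange M,
      k : d'.-tuple int <- hcross d' (M %/ `|z|.+1)]
  else if (0 < M)%N then [:: [tuple]] else [::].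

Lemma mem_zrange M z : (z \in zrange M) = (`|z| < M)%N.
Proof.
case: M => [|M]; first by rewrite in_nil ltn0.
rewrite inE mem_cat; case: z => [[|i]|i] /=.
- by [].
- rewrite -[LHS]/(_ || _) (_ : (_ \in map Negz _) = false) ?orbF; last by apply/mapP => -[].
  rewrite (@mem_map _ _ (fun i => i.+1%:Z)) ?mem_iota ?add0n ?leq0n//.
  by move=> a b [].
- rewrite -[LHS]/(_ || _) (_ : (_ \in map _ _) = false) ?orFb; last by apply/mapP => -[].
  by rewrite mem_map ?mem_iota ?add0n ?leq0n// => a b [].
Qed.

Lemma uniq_zrange M : uniq (zrange M).
Proof.
case: M => //= M; apply/andP; split.
  by rewrite mem_cat negb_or; apply/andP; split; apply/mapP => -[].
rewrite cat_uniq !map_inj_uniq ?iota_uniq//=; last by move=> a b [].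
  rewrite andbT; apply/hasPn => z /mapP[i _ ->].
  by apply/mapP => -[].
by move=> a b [].
Qed.

Lemma hweight_cons d (z : int) (k : d.-tuple int) :
  hweight [tuple of z :: k] = (`|z|.+1 * hweight k)%N.
Proof.
rewrite /hweight big_ord_recl tnth0; congr (_ * _)%N.
by apply: eq_bigr => j _; rewrite tnthS.
Qed.

Lemma hweight_gt0 d (k : d.-tuple int) : (0 < hweight k)%N.
Proof. by apply: prodn_gt0. Qed.

Lemma mem_hcross d M (k : d.-tuple int) : (k \in hcross d M) = (hweight k <= M)%N.
Proof.
elim: d M k => [|d IH] M k /=.
  by rewrite (tuple0 k) /hweight big_ord0; case: M.
case/tupleP: k => z k; rewrite hweight_cons.
apply/allpairsPdep/idP => [[z' [k' [zM kM /(congr1 val)/= [-> /val_inj ->]]]]|h].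
  by move: kM; rewrite IH leq_divRL// mulnC.
exists z, k; split => //; last by rewrite IH leq_divRL// mulnC.
rewrite mem_zrange; apply: leq_trans h.
by rewrite leq_pmulr// hweight_gt0.
Qed.

Lemma uniq_hcross d M : uniq (hcross d M).
Proof.
elim: d M => [|d IH] M /=; first by case: ifP.
apply: allpairs_uniq_dep => //; first exact: uniq_zrange.
by move=> [z1 k1] [z2 k2] _ _ /= /(congr1 val)/= [-> /val_inj ->].
Qed.

(** The layers [z] and [- z] have equal size, and [i.+2] is [|z| + 1] for [|z| = i + 1]. *)
Lemma size_hcross d M : (0 < M)%N ->
  size (hcross d.+1 M) =
  (size (hcross d M) + 2 * \sum_(0 <= i < M.-1) size (hcross d (M %/ i.+2)))%N.
Proof.
case: M => // M _; rewrite /= size_cat size_map divn1; congr (_ + _)%N.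
rewrite size_allpairs_dep map_cat sumn_cat -!map_comp !sumnE !big_map.
by rewrite mul2n -addnn /index_iota subn0.
Qed.

(** * Discrete mean value inequalities for powers *)

Section power_differences.
Variable R : realFieldType.
Implicit Types u v : R.

(** In the factorization of [v ^ k.+1 - u ^ k.+1] by [v - u], each of the [k + 1] terms of the
    cofactor is at least [u ^ k] (and, for [exprB_le], at most [v ^ k]). *)
Lemma exprB_ge u v k : 0 <= u -> u <= v ->
  k.+1%:R * (v - u) * u ^+ k <= v ^+ k.+1 - u ^+ k.+1.
Proof.
move=> u0 uv; rewrite subrXX -mulrA mulrCA; apply: ler_wpM2l; first by rewrite subr_ge0.
rewrite mulr_natl -[k.+1 in X in X <= _]card_ord -sumr_const; apply: ler_sum => i _.
have ik : (i <= k)%N by rewrite -ltnS.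
rewrite -[in X in X <= _](subnK ik) exprD; apply: ler_wpM2r; first exact: exprn_ge0.
by apply: lerXn2r; rewrite ?nnegrE// (le_trans u0 uv).
Qed.

Lemma exprB_le u v k : 0 <= u -> u <= v ->
  v ^+ k.+1 - u ^+ k.+1 <= k.+1%:R * (v - u) * v ^+ k.
Proof.
move=> u0 uv; rewrite subrXX -mulrA mulrCA; apply: ler_wpM2l; first by rewrite subr_ge0.
have v0 := le_trans u0 uv.
rewrite mulr_natl -[k.+1 in X in _ <= X]card_ord -sumr_const; apply: ler_sum => i _.
have ik : (i <= k)%N by rewrite -ltnS.
rewrite -[in X in _ <= X](subnK ik) exprD; apply: ler_wpM2l.
  exact: exprn_ge0.
by apply: lerXn2r; rewrite ?nnegrE.
Qed.

End power_differences.

(** * Counting the points of a hyperbolic cross *)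

Section counting.
Variable R : realType.
Implicit Types r : R.

Lemma ln_succ_le (m : nat) : (0 < m)%N -> ln (m.+1%:R / m%:R : R) <= m%:R^-1.
Proof.
move=> m0; have mR : 0 < m%:R :> R by rewrite ltr0n.
rewrite -natr1 mulrDl divff ?gt_eqF// mul1r; apply: le_ln1Dx.
by apply: lt_le_trans (_ : 0 <= _); rewrite ?invr_ge0 ?ltW ?oppr_lt0.
Qed.

(** The inequality [ln (1 + x) <= x] is applied to the reciprocal [m / (m + 1)], that is, at
    [x = - 1 / (m + 1)]. *)
Lemma ln_succ_ge (m : nat) : (0 < m)%N -> m.+1%:R^-1 <= ln (m.+1%:R / m%:R : R).
Proof.
move=> m0; have mR : 0 < m%:R :> R by rewrite ltr0n.
have m1 : 0 < m.+1%:R :> R by rewrite ltr0n.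
rewrite -[_ / _]invrK lnV ?posrE ?invr_gt0 ?divr_gt0// lerNr invf_div.
have -> : m%:R / m.+1%:R = 1 + (- m.+1%:R^-1) :> R.
  by rewrite -natr1; field; rewrite natr1 gt_eqF.
apply: le_ln1Dx; rewrite ltrN2 invf_lt1// ltr1n//.
Qed.

Lemma hcross0 d : hcross d 0 = [::].
Proof. by case: d. Qed.

Lemma size_hcross1 M : (0 < M)%N -> size (hcross 1 M) = (1 + 2 * M.-1)%N.
Proof.
move=> M0; rewrite size_hcross//= M0/=; congr (1 + 2 * _)%N.
rewrite -[RHS]muln1 -[X in (X * 1)%N](subn0 M.-1) -sum_nat_const_nat.
apply: eq_big_nat => i /andP[_ iM].
by rewrite divn_gt0// ifT//; lia.
Qed.

(** The shift [d / 2] closes the induction. With [x = ln r + d / 2], and up to the factor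
    [2 ^ d.+1 * r], the layer [z = 0] contributes [x^d / d!] and the other layers at most
    [2 x^(d+1) / (d+1)!]; by [exprB_ge] the sum is at most [2 (x + 1/2)^(d+1) / (d+1)!]. *)
Lemma size_hcross_le d M r : 1 <= r -> M%:R <= r ->
  (size (hcross d.+1 M))%:R <=
    2 ^+ d.+1 * r * (ln r + d%:R / 2) ^+ d / d`!%:R.
Proof.
elim: d M r => [|d IH] M r r1 Mr.
  rewrite expr0 mulr1 fact0 divr1 expr1.
  case: M Mr => [|M] Mr; first by rewrite hcross0/=; lra.
  by rewrite size_hcross1//= natrD natrM; move: Mr; rewrite -natr1; lra.
have L0 : 0 <= ln r by exact: ln_ge0.
have d0 : 0 <= d%:R / 2 :> R by rewrite divr_ge0.
case: M Mr => [|M] Mr.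
  rewrite hcross0/= divr_ge0// mulr_ge0 ?exprn_ge0 ?addr_ge0//.
  by rewrite mulr_ge0 ?exprn_ge0//; lra.
rewrite size_hcross// natrD natrM natr_sum /=.
(* The decrements of [G] dominate [(1 / m) (ln (r / m) + d / 2) ^ d], because the logarithm drops by
   at least [1 / m] from [m - 1] to [m]. The sum over [m >= 2] is therefore at most [G 1]. *)
pose G m : R := (ln (r / m%:R) + d%:R / 2) ^+ d.+1 / d.+1%:R.
have r0 : 0 < r by lra.
have C0 : 0 <= 2 ^+ d.+1 * r / d`!%:R :> R.
  by rewrite divr_ge0// mulr_ge0 ?mulr_ge0 ?exprn_ge0//; lra.
have step i : (i < M)%N -> (size (hcross d.+1 (M.+1 %/ i.+2)))%:R <=
    2 ^+ d.+1 * r / d`!%:R * (G i.+1 - G i.+2).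
  move=> iM; have i2 : 0 < i.+2%:R :> R by rewrite ltr0n.
  have i1 : 0 < i.+1%:R :> R by rewrite ltr0n.
  have ri : 1 <= r / i.+2%:R.
    by rewrite ler_pdivlMr// mul1r (le_trans _ Mr)// ler_nat.
  apply: le_trans (IH _ (r / i.+2%:R) ri _) _.
    rewrite ler_pdivlMr// -natrM (le_trans _ Mr)// ler_nat.
    exact: leq_trunc_div.
  rewrite [X in X <= _](_ : _ = 2 ^+ d.+1 * r / d`!%:R *
    (i.+2%:R^-1 * (ln (r / i.+2%:R) + d%:R / 2) ^+ d)); last by ring.
  apply: ler_wpM2l => //.
  rewrite /G -mulrBl ler_pdivlMr//.
  have E : ln (r / i.+1%:R) = ln (r / i.+2%:R) + ln (i.+2%:R / i.+1%:R).
    by rewrite -lnM ?posrE ?divr_gt0// mulrA divfK// gt_eqF.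
  apply: le_trans (exprB_ge d _ _); last 2 first.
  - by rewrite addr_ge0// ln_ge0.
  - rewrite E lerD2r lerDl; apply: ln_ge0.
    by rewrite ler_pdivlMr// mul1r ler_nat.
  rewrite mulrC mulrA; apply: ler_wpM2r.
    by rewrite exprn_ge0// addr_ge0// ln_ge0.
  rewrite ler_wpM2l// E; apply: le_trans (ln_succ_ge _) _ => //.
  by rewrite le_eqVlt; apply/orP; left; apply/eqP; ring.
have sum_le : \sum_(0 <= i < M) (size (hcross d.+1 (M.+1 %/ i.+2)))%:R <=
    2 ^+ d.+1 * r / d`!%:R * G 1%N.
  apply: le_trans (_ : \sum_(0 <= i < M)
      2 ^+ d.+1 * r / d`!%:R * (G i.+1 - G i.+2) <= _).
    by apply: ler_sum_nat => i /andP[_ iM]; exact: step.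
  rewrite -mulr_sumr ler_wpM2l//.
  rewrite (eq_bigr (fun i => (- G i.+2) - (- G i.+1))); last first.
    by move=> i _; rewrite opprK addrC.
  rewrite (telescope_sumr (fun i => - G i.+1))// opprK gerDr oppr_le0.
  rewrite /G divr_ge0// exprn_ge0// addr_ge0// ln_ge0//.
  by rewrite ler_pdivlMr ?ltr0n// mul1r.
have first_le : (size (hcross d.+1 M.+1))%:R <=
    2 ^+ d.+1 * r / d`!%:R * (ln r + d%:R / 2) ^+ d.
  by rewrite mulrAC; exact: IH.
apply: le_trans (lerD first_le (ler_wpM2l _ sum_le)) _ => //.
rewrite /G divr1 factS natrM.
set x := ln r + d%:R / 2.
have x0 : 0 <= x by rewrite addr_ge0.
have -> : ln r + d.+1%:R / 2 = x + 2^-1 by rewrite /x -natr1; ring.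
have := @exprB_ge _ x (x + 2^-1) d x0 _.
rewrite (_ : x + _ - x = 2^-1); last by ring.
move=> /(_ ltac:(lra)) key.
have dp : 0 < d.+1%:R :> R by rewrite ltr0n.
have fp : 0 < d`!%:R :> R by rewrite ltr0n fact_gt0.
have -> : 2 ^+ d.+2 * r * (x + 2^-1) ^+ d.+1 / (d.+1%:R * d`!%:R) =
  2 ^+ d.+1 * r / d`!%:R * (2 * (x + 2^-1) ^+ d.+1 / d.+1%:R).
  by rewrite (exprS _ d.+1); field; rewrite !gt_eqF.
rewrite mulrCA -mulrDr ler_wpM2l// -(ler_pM2r dp) mulrDl divfK ?gt_eqF//.
rewrite mulrA divfK ?gt_eqF//; move: key; set a := x ^+ d; lra.
Qed.

(** In dimension one the count [2 M - 1] exceeds [2 r - 3], which is at least [3 r / 2] exactly when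
    [r >= 6]: hence the factor 3/4 and the threshold [3 * 2]. Each further dimension doubles the
    threshold, since the layer [z = 0] is dropped and the telescoping sum starts at [m = 2]. *)
Lemma size_hcross_ge d M r : 3 * 2 ^+ d.+1 <= r -> r < M.+1%:R ->
  3 / 4 * 2 ^+ d.+1 * r * ln (r / (3 * 2 ^+ d.+1)) ^+ d / d`!%:R <=
    (size (hcross d.+1 M))%:R.
Proof.
elim: d M r => [|d IH] M r rc rM.
  rewrite expr0 mulr1 fact0 divr1 expr1.
  move: rc; rewrite expr1 => rc.
  case: M rM => [|M] rM; first lra.
  by rewrite size_hcross1//= natrD natrM; move: rM; rewrite -[M.+2%:R]natr1 -[M.+1%:R]natr1; lra.
set c : R := 3 * 2 ^+ d.+1 in IH.
have cE : c = 3 * 2 ^+ d.+1 by [].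
clearbody c.
have c1 : 1 <= c.
  have : 1 <= 2 ^+ d.+1 :> R by rewrite exprn_ege1//; lra.
  by rewrite cE; lra.
have rc2 : 2 * c <= r by move: rc; rewrite cE exprS; lra.
have r0 : 0 < r by lra.
have C0 : 0 <= 3 / 4 * 2 ^+ d.+1 * r / d`!%:R :> R.
  by rewrite divr_ge0// mulr_ge0 ?mulr_ge0 ?exprn_ge0//; lra.
case: M rM => [|M] rM; first lra.
pose u m : R := ln (r / (m%:R * c)).
(* Cutting at 0 discards the layers for which [r / m] is below the threshold [c] of the induction
   hypothesis. *)
pose G m : R := Num.max 0 (u m) ^+ d.+1 / d.+1%:R.
have step i : (i < M)%N -> 3 / 4 * 2 ^+ d.+1 * r / d`!%:R * (G i.+2 - G i.+3) <=
    (size (hcross d.+1 (M.+1 %/ i.+2)))%:R.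
  move=> iM; have i2 : 0 < i.+2%:R :> R by rewrite ltr0n.
  have i3 : 0 < i.+3%:R :> R by rewrite ltr0n.
  have E : u i.+2 = u i.+3 + ln (i.+3%:R / i.+2%:R).
    rewrite /u -lnM ?posrE ?divr_gt0// ?mulr_gt0//; try lra.
    move: i2 i3; set a : R := i.+2%:R; set b : R := i.+3%:R => i2 i3.
    by congr ln; field; rewrite !gt_eqF//; lra.
  have L0 : 0 <= ln (i.+3%:R / i.+2%:R) :> R.
    by apply: ln_ge0; rewrite ler_pdivlMr// mul1r ler_nat.
  have [u2|u2] := leP 0 (u i.+2); last first.
    have u3 : u i.+3 < 0 by apply: le_lt_trans u2; rewrite E lerDl.
    by rewrite /G (max_l (ltW u2)) (max_l (ltW u3)) subrr mulr0.
  have ric : c <= r / i.+2%:R.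
    have ic0 : 0 < i.+2%:R * c by rewrite mulr_gt0//; lra.
    have : 1 <= r / (i.+2%:R * c).
      rewrite leNgt; apply/negP => h; move: u2; apply/negP; rewrite -ltNge.
      by apply: ln_lt0; rewrite h andbT divr_gt0.
    by rewrite (ler_pdivlMr _ _ ic0) mul1r (ler_pdivlMr _ _ i2) mulrC.
  apply: le_trans (IH _ (r / i.+2%:R) ric _); last first.
    rewrite ltr_pdivrMr// -natrM (lt_le_trans rM)// ler_nat.
    by rewrite mulSn [in X in (X < _)%N](divn_eq M.+1 i.+2) addnC ltn_add2r ltn_pmod.
  rewrite [X in _ <= X](_ : _ = 3 / 4 * 2 ^+ d.+1 * r / d`!%:R *
    (i.+2%:R^-1 * ln (r / i.+2%:R / c) ^+ d)); last by ring.
  apply: ler_wpM2l => //.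
  have -> : ln (r / i.+2%:R / c) = u i.+2.
    by rewrite /u -mulrA -invfM.
  rewrite /G -mulrBl ler_pdivrMr// [in X in X <= _]max_r//.
  apply: le_trans (exprB_le d _ _) _.
  - by rewrite le_max lexx.
  - by rewrite ge_max u2 E lerDl.
  rewrite -mulrA [leRHS]mulrC; apply: ler_wpM2l => //.
  apply: ler_wpM2r; first exact: exprn_ge0.
  apply: le_trans (ln_succ_le _) => //.
  have : u i.+3 <= Num.max 0 (u i.+3) by rewrite le_max lexx orbT.
  rewrite E; lra.
rewrite size_hcross// natrD natrM natr_sum /=.
have sum_ge : 3 / 4 * 2 ^+ d.+1 * r / d`!%:R * G 2%N <=
    \sum_(0 <= i < M) (size (hcross d.+1 (M.+1 %/ i.+2)))%:R.
  apply: le_trans (_ : \sum_(0 <= i < M)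
      3 / 4 * 2 ^+ d.+1 * r / d`!%:R * (G i.+2 - G i.+3) <= _); last first.
    by apply: ler_sum_nat => i /andP[_ iM]; exact: step.
  rewrite -mulr_sumr ler_wpM2l//.
  rewrite (eq_bigr (fun i => (- G i.+3) - (- G i.+2))); last first.
    by move=> i _; rewrite opprK addrC.
  rewrite (telescope_sumr (fun i => - G i.+2))// opprK lerDr oppr_ge0.
  (* The last term of the telescoping sum vanishes: [r < M + 2] and [c >= 1] make its logarithm
     nonpositive. *)
  rewrite /G max_l ?expr0n ?mul0r//.
  apply: ln_le0; rewrite ler_pdivrMr ?mulr_gt0 ?ltr0n//; last lra.
  by rewrite mul1r (le_trans (ltW rM))// ler_peMr.
(* Only the layers with [z != 0] are kept. *)
apply: le_trans (_ : 2 * (3 / 4 * 2 ^+ d.+1 * r / d`!%:R * G 2%N) <= _); last first.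
  by apply: le_trans (ler_wpM2l _ sum_ge) _ => //; rewrite lerDr.
have E2 : u 2%N = ln (r / (3 * 2 ^+ d.+2)).
  by rewrite /u; congr (ln (_ / _)); rewrite cE (exprS _ d.+1); ring.
rewrite /G max_r; last first.
  by apply: ln_ge0; rewrite ler_pdivlMr ?mulr_gt0//; lra.
rewrite E2 factS natrM.
have dp : 0 < d.+1%:R :> R by rewrite ltr0n.
have fp : 0 < d`!%:R :> R by rewrite ltr0n fact_gt0.
rewrite le_eqVlt; apply/orP; left; apply/eqP.
by rewrite (exprS 2 d.+1); field; rewrite !gt_eqF.
Qed.

End counting.

(** * The radii belonging to n *)

Section counting_bounds.
Variable R : realType.

(** From [e^(-1/4) >= 1 - 1/4] follows [e <= (4/3)^4], and [(4/3)^8] is less than 12. *)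
Lemma expR1_sqr_le12 : expR 1 ^+ 2 <= 12 :> R.
Proof.
have h : 3 / 4 <= expR (- (1 / 4)) :> R.
  by apply: le_trans (expR_ge1Dx _); lra.
have e4 : expR 1 = expR (1 / 4) ^+ 4 :> R.
  by rewrite -expRM_natl; congr expR; lra.
have h' : expR (1 / 4) <= 4 / 3 :> R.
  rewrite -[X in X <= _]invrK -expRN invf_ple ?posrE ?expR_gt0//.
  by rewrite invf_div.
rewrite e4 -exprM; apply: le_trans (_ : (4 / 3) ^+ (4 * 2) <= _); last by lra.
by apply: lerXn2r; rewrite ?nnegrE ?expR_ge0//; lra.
Qed.

Lemma ln12_ge2 : 2 <= ln 12 :> R.
Proof.
rewrite -[X in X <= _](@expRK R) ler_ln ?posrE ?expR_gt0//.
by rewrite -[2]mulr1 expRM_natl expR1_sqr_le12.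
Qed.

Lemma expn_ln_le (a : R) d n : 0 < a -> a ^+ d <= n%:R -> d%:R * ln a <= ln n%:R.
Proof.
move=> a0 an; have an0 : 0 < a ^+ d by rewrite exprn_gt0.
by rewrite mulr_natl -lnXn// ler_ln ?posrE// (lt_le_trans an0 an).
Qed.

Lemma expn_ln_lt (a : R) d n : 0 < a -> a ^+ d < n%:R -> d%:R * ln a < ln n%:R.
Proof.
move=> a0 an; have an0 : 0 < a ^+ d by rewrite exprn_gt0.
by rewrite mulr_natl -lnXn// ltr_ln ?posrE// (lt_trans an0 an).
Qed.

Lemma fact_le_expn d : (d`! <= d ^ d)%N.
Proof.
elim: d => // d IH; rewrite factS expnS leq_mul2l; apply: leq_trans IH _.
by case: d => // d; rewrite leq_exp2r.
Qed.

(** A weak Stirling bound. The induction step costs [(d + 1) ln ((d + 2) / (d + 1))], which is at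
    most 1. *)
Lemma ln_fact_ge d : d.+1%:R * ln d.+1%:R - d%:R <= ln (d.+1)`!%:R :> R.
Proof.
elim: d => [|d IH]; first by rewrite (_ : 1`! = 1)%N// ln1 mulr0 subrr.
rewrite [d.+2`!]factS natrM lnM ?posrE ?ltr0n ?fact_gt0//.
have h : d.+1%:R * ln (d.+2%:R / d.+1%:R) <= 1 :> R.
  rewrite -ler_pdivlMl ?ltr0n// mulr1; exact: ln_succ_le.
move: h; rewrite ln_div ?posrE ?ltr0n//.
move: IH; move: (ln d.+2%:R) (ln d.+1%:R) (ln d.+1`!%:R) => a b c.
rewrite -[d.+2%:R]natr1 -[d.+1%:R]natr1; lra.
Qed.

Definition upper_radius d n : R := n%:R * d`!%:R / (3 ^+ d.+1 * ln n%:R ^+ d).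

Lemma size_hcross_upper d n M : (27 ^ d.+1 <= n)%N ->
  M%:R <= upper_radius d n -> (size (hcross d.+1 M) < n)%N.
Proof.
move=> hn Mr; set y : R := ln n%:R.
have n0 : (0 < n)%N by apply: leq_trans hn; rewrite expn_gt0.
case: M Mr => [|M] Mr; first by rewrite hcross0.
have ln27 : 1 <= ln 27 :> R.
  by apply: le_trans (_ : ln 12 <= _); [have := ln12_ge2; lra|rewrite ler_ln ?posrE; lra].
have yd : d.+1%:R <= y.
  have : d.+1%:R * ln 27 <= y by apply: expn_ln_le => //; rewrite -natrX ler_nat.
  by apply: le_trans; rewrite ler_peMr.
have y0 : 0 < y by apply: lt_le_trans yd; rewrite ltr0n.
have nR : 0 < n%:R :> R by rewrite ltr0n.
have fp : 0 < d`!%:R :> R by rewrite ltr0n fact_gt0.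
have yn0 : 0 < y ^+ d by rewrite exprn_gt0.
set r := upper_radius d n in Mr *.
have r1 : 1 <= r by apply: le_trans Mr; rewrite ler1n.
(* This gives [ln r <= ln n]; it holds because [d! <= d^d <= (ln n)^d]. *)
have rn : r <= n%:R.
  rewrite /r /upper_radius -/y ler_pdivrMr ?mulr_gt0 ?exprn_gt0//.
  apply: ler_wpM2l => //; apply: le_trans (_ : y ^+ d <= _).
    apply: le_trans (_ : d%:R ^+ d <= _); first by rewrite -natrX ler_nat fact_le_expn.
    apply: lerXn2r; rewrite ?nnegrE// ?(ltW y0)//.
    by apply: le_trans yd; rewrite ler_nat.
  by rewrite ler_peMl ?exprn_ege1 ?ltW//; lra.
rewrite -(ltr_nat R); apply: le_lt_trans (size_hcross_le d r1 Mr) _.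
have lr : ln r <= y by rewrite ler_ln ?posrE//; lra.
have dy : d%:R <= y by apply: le_trans yd; rewrite ler_nat.
(* As [ln r <= y] and [d <= y], the shifted logarithm is at most [3 y / 2]. The power [3 ^ d.+1] in
   the radius then leaves a count of at most [2 n / 3]. *)
apply: le_lt_trans (_ : 2 ^+ d.+1 * r * (3 / 2 * y) ^+ d / d`!%:R < _).
  rewrite ler_pM2r ?invr_gt0//; apply: ler_wpM2l.
    by rewrite mulr_ge0 ?exprn_ge0//; lra.
  by apply: lerXn2r; rewrite ?nnegrE ?addr_ge0 ?ln_ge0 ?divr_ge0 ?mulr_ge0//; lra.
have -> : 2 ^+ d.+1 * r * (3 / 2 * y) ^+ d / d`!%:R = 2 / 3 * n%:R.
  rewrite /r /upper_radius -/y exprMn expr_div_n !exprS.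
  by field; rewrite !gt_eqF ?exprn_gt0.
by lra.
Qed.

Definition lower_radius d n : R :=
  n%:R * d.+1`!%:R * (2 + ln 12) ^+ d.+1 / (3 * 2 ^+ d.+1 * ln n%:R ^+ d).

(** With [y = ln n], [D = 2 + ln 12] and [L = ln (r / (3 * 2 ^ d.+1))], the bound of
    [size_hcross_ge] equals [n ((d + 1) D / 4) (D L / y)^d]. So the matter reduces to [D >= 4] and
    [y <= D L]. *)
Lemma size_hcross_lower d n : (12 * expR 1 ^+ 2) ^+ d.+1 < n%:R :> R ->
  exists2 M, M%:R <= lower_radius d n & (n <= size (hcross d.+1 M))%N.
Proof.
move=> hn; set y : R := ln n%:R; pose D : R := 2 + ln 12.
have D4 : 4 <= D by have := ln12_ge2; rewrite /D; lra.
have yD : d.+1%:R * D <= y.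
  have -> : D = ln (12 * expR 1 ^+ 2).
    by rewrite lnM ?posrE ?exprn_gt0 ?expR_gt0// lnXn ?expR_gt0// expRK addrC.
  by apply: ltW; apply: expn_ln_lt => //; rewrite mulr_gt0 ?exprn_gt0 ?expR_gt0.
have nR : 0 < n%:R :> R.
  by apply: lt_trans hn; rewrite exprn_gt0// mulr_gt0 ?exprn_gt0 ?expR_gt0.
have d0 : 0 < d.+1%:R :> R by rewrite ltr0n.
have D0 : 0 < D by lra.
have y0 : 0 < y by apply: lt_le_trans yD; rewrite mulr_gt0.
have fp : 0 < d`!%:R :> R by rewrite ltr0n fact_gt0.
have f1p : 0 < d.+1`!%:R :> R by rewrite ltr0n fact_gt0.
set r := lower_radius d n.
have r0 : 0 < r.
  by rewrite /r /lower_radius divr_gt0// ?mulr_gt0// ?exprn_gt0.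
pose L := ln (r / (3 * 2 ^+ d.+1)).
have LE : L = y + ln d.+1`!%:R + d.+1%:R * ln D - 2 * ln 3 - 2 * d.+1%:R * ln 2
    - d%:R * ln y.
  rewrite /L /r /lower_radius -/y -/D.
  rewrite ln_div ?posrE ?divr_gt0 ?mulr_gt0 ?exprn_gt0//.
  rewrite ln_div ?posrE ?mulr_gt0 ?exprn_gt0//.
  rewrite !lnM ?posrE ?mulr_gt0 ?exprn_gt0// !lnXn//.
  rewrite -/y -(mulr_natl (ln D)) -(mulr_natl (ln 2)) -(mulr_natl (ln y)); ring.
have yL : y <= D * L.
  have l12 : D = 2 + ln 3 + 2 * ln 2.
    have E : 12 = 3 * 2 ^+ 2 :> R by lra.
    by rewrite /D E lnM ?posrE ?exprn_gt0// lnXn// mulr_natl addrA.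
  (* This is the tangent of [ln] at [(d + 1) D], the least value that [yD] allows for [y]. Taken [d]
     times, its terms [ln (d + 1) - 1] are offset by the Stirling bound for [(d + 1)!]. *)
  have ly : ln y <= ln d.+1%:R + ln D + y / (d.+1%:R * D) - 1.
    rewrite -lnM ?posrE//.
    have q0 : 0 < y / (d.+1%:R * D) by rewrite divr_gt0 ?mulr_gt0.
    have : ln (1 + (y / (d.+1%:R * D) - 1)) <= y / (d.+1%:R * D) - 1.
      by apply: le_ln1Dx; rewrite ltrDr.
    rewrite addrC subrK ln_div ?posrE ?mulr_gt0//.
    by rewrite lerBlDl addrA.
  have lD : ln 3 <= ln D by rewrite ler_ln ?posrE//; lra.
  have ld : 0 <= ln d.+1%:R :> R by rewrite ln_ge0// ler1n.
  have l3 : 0 <= ln 3 :> R by apply: ln_ge0; lra.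
  have dly : d%:R * ln y <= d%:R * (ln d.+1%:R + ln D - 1) + y / D.
    apply: le_trans (ler_wpM2l _ ly) _ => //.
    rewrite [leLHS](_ : _ = d%:R * (ln d.+1%:R + ln D - 1 + y / (d.+1%:R * D)));
      last by congr (_ * _); rewrite [RHS]addrAC.
    rewrite mulrDr lerD2l mulrA ler_pdivrMr ?mulr_gt0// mulrA mulrAC.
    rewrite divfK ?gt_eqF// mulrC ler_wpM2l ?ltW//.
    by rewrite ltr_nat.
  have Lge : y - y / D + ln d.+1%:R + ln D - 2 * ln 3 - 2 * d.+1%:R * ln 2 <= L.
    rewrite LE; have := ln_fact_ge d; move: dly.
    move: (ln y) (ln d.+1%:R) (ln d.+1`!%:R) (ln D) => a b c e.
    rewrite -[d.+1%:R]natr1; lra.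
  apply: le_trans (ler_wpM2l (ltW D0) Lge).
  (* Since [D - 2 = ln 12 = ln 3 + 2 ln 2], the lower bound [(D - 2) (d + 1) D] for [(D - 2) y]
     equals the negative term of the difference below; [p1] covers what is left. *)
  have yDd : (D - 2) * (d.+1%:R * D) <= (D - 2) * y by apply: ler_wpM2l => //; lra.
  have p1 : 0 <= D * (d%:R * ln 3 + ln d.+1%:R + (ln D - ln 3)).
    apply: mulr_ge0; first lra.
    by apply: addr_ge0; [apply: addr_ge0 => //; exact: mulr_ge0|lra].
  rewrite -subr_ge0.
  have -> : D * (y - y / D + ln d.+1%:R + ln D - 2 * ln 3 - 2 * d.+1%:R * ln 2) - y
    = (D - 2) * y - D * d.+1%:R * (ln 3 + 2 * ln 2) +
      D * (d%:R * ln 3 + ln d.+1%:R + (ln D - ln 3)).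
    by rewrite -[d.+1%:R]natr1; field; rewrite gt_eqF.
  rewrite addr_ge0// subr_ge0; apply: le_trans yDd.
  have -> : ln 3 + 2 * ln 2 = D - 2 by rewrite l12; ring.
  by rewrite le_eqVlt; apply/orP; left; apply/eqP; ring.
have L0 : 0 < L by rewrite -(pmulr_rgt0 _ D0); exact: lt_le_trans yL.
have rc : 3 * 2 ^+ d.+1 <= r.
  have c0 : 0 < 3 * 2 ^+ d.+1 :> R by rewrite mulr_gt0 ?exprn_gt0.
  rewrite -[X in X <= _]mul1r -ler_pdivlMr// leNgt; apply/negP => h.
  by have := ln_lt0 (x := r / (3 * 2 ^+ d.+1)); rewrite h divr_gt0// ltNge (ltW L0) => /(_ isT).
have /andP[Mr rM] := truncn_itv (ltW r0).
exists (Num.truncn r) => //; rewrite -(ler_nat R).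
apply: le_trans (size_hcross_ge rc rM); rewrite -/L.
have -> : 3 / 4 * 2 ^+ d.+1 * r * L ^+ d / d`!%:R =
    n%:R * ((d.+1%:R * D / 4) * (D * L / y) ^+ d).
  rewrite /r /lower_radius -/y -/D factS natrM expr_div_n (exprMn _ D).
  rewrite (exprS D) (exprS 2 d).
  have yn0 : 0 < y ^+ d by rewrite exprn_gt0.
  have tn0 : 0 < 2 ^+ d :> R by rewrite exprn_gt0.
  move: (D ^+ d) (L ^+ d) (y ^+ d) yn0 (2 ^+ d) tn0 => a b c c0 e e0.
  by field; rewrite !gt_eqF.
rewrite ler_peMr ?(ltW nR)//; apply: mulr_ege1.
  rewrite ler_pdivlMr// mul1r; apply: le_trans D4 _.
  by rewrite ler_peMl ?(ltW D0)// ler1n.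
by apply: exprn_ege1; rewrite ler_pdivlMr// mul1r.
Qed.

End counting_bounds.

(** * Comparison of the weights *)

Section weights.
Variable R : realType.
Implicit Types (p s x r : R) (d : nat).

(** Split [(1 + x)^p] into [(1 + x)^(p - 1)] and [x (1 + x)^(p - 1)]; the first is at least 1, the
    second at least [x * x^(p - 1)]. *)
Lemma powR_superadd p x : 1 <= p -> 0 <= x -> 1 + x `^ p <= (1 + x) `^ p.
Proof.
move=> p1 x0; have p0 : 0 < p by lra.
have x1 : 1 <= 1 + x by lra.
rewrite -[leRHS]mulr_powRB1//; last lra.
rewrite mulrDl mul1r; apply: lerD.
  by rewrite -[leLHS](powRr0 (1 + x)) ler_powR//; lra.
rewrite -(mulr_powRB1 x0 p0); apply: ler_wpM2l => //.
by apply: ge0_ler_powR; rewrite ?nnegrE//; lra.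
Qed.

(** Convexity of the power at the midpoint of 1 and [x], multiplied by [2 ^ p]. *)
Lemma powR_convex_half p x : 1 <= p -> 0 <= x ->
  (1 + x) `^ p <= 2 `^ (p - 1) * (1 + x `^ p).
Proof.
move=> p1 x0.
have h0 : 0 <= 2^-1 :> R by lra.
have h1 : 2^-1 <= 1 :> R by lra.
have cE (a b : R) : conv (Itv01 h0 h1) (a : R^o) b = 2^-1 * (a + b).
  by rewrite convRE/= /unstable.onem; lra.
have : (conv (Itv01 h0 h1) (1 : R^o) x) `^ p <=
    conv (Itv01 h0 h1) (1 `^ p : R^o) (x `^ p).
  by apply: convex_powR => //; rewrite inE/= in_itv/= ?ler01 ?x0.
rewrite !cE powR1 powRM//; last by rewrite addr_ge0.
have V : 2 `^ p * 2^-1 `^ p = 1 :> R.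
  by rewrite -powRM ?invr_ge0// divff// powR1.
have p20 : 0 < 2 `^ p :> R by apply: powR_gt0.
rewrite -(ler_pM2l p20) mulrA V mul1r => /le_trans; apply.
by rewrite powRB ?pnatr_eq0 ?implybT// powRr1// mulrA.
Qed.

(** Apply [powR_superadd] with exponent [1 / p] to [x ^ p], then raise to the power [p]. The passage
    from [powR_convex_half] to [powR_concave_half] is the same. *)
Lemma powR_subadd p x : 0 < p -> p <= 1 -> 0 <= x -> (1 + x) `^ p <= 1 + x `^ p.
Proof.
move=> p0 p1 x0; have := @powR_superadd p^-1 (x `^ p).
rewrite invf_ge1// => /(_ p1 (powR_ge0 _ _)).
rewrite -powRrM mulfV ?gt_eqF// powRr1// => h.
have := @ge0_ler_powR R p (ltW p0) _ _ _ _ h.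
rewrite -powRrM mulVf ?gt_eqF// powRr1 ?addr_ge0 ?powR_ge0//; apply.
- by rewrite nnegrE addr_ge0.
- by rewrite nnegrE powR_ge0.
Qed.

Lemma powR_concave_half p x : 0 < p -> p <= 1 -> 0 <= x ->
  1 + x `^ p <= 2 `^ (1 - p) * (1 + x) `^ p.
Proof.
move=> p0 p1 x0; have := @powR_convex_half p^-1 (x `^ p).
rewrite invf_ge1// => /(_ p1 (powR_ge0 _ _)).
rewrite -powRrM mulfV ?gt_eqF// powRr1// => h.
have := @ge0_ler_powR R p (ltW p0) _ _ _ _ h.
rewrite -powRrM mulVf ?gt_eqF// powRr1 ?addr_ge0 ?powR_ge0//.
rewrite powRM ?powR_ge0 ?addr_ge0// -powRrM mulrBl mulVf ?gt_eqF// mul1r; apply.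
- by rewrite nnegrE powR_ge0.
- by rewrite nnegrE mulr_ge0 ?powR_ge0 ?addr_ge0.
Qed.

Lemma powR_prod (I : Type) (t : seq I) (F : I -> R) p : (forall i, 0 <= F i) ->
  (\prod_(i <- t) F i) `^ p = \prod_(i <- t) F i `^ p.
Proof.
move=> F0; elim: t => [|i t IH]; first by rewrite !big_nil powR1.
by rewrite !big_cons powRM ?prodr_ge0// IH.
Qed.

Lemma hweight_powR d (k : d.-tuple int) p :
  (hweight k)%:R `^ p = \prod_(j < d) (1 + `|(tnth k j)%:~R : R|) `^ p.
Proof.
rewrite /hweight natr_prod powR_prod//; apply: eq_bigr => j _; congr (_ `^ _).
by rewrite -natr1 addrC -intr_norm -abszE pmulrn.
Qed.

Lemma mix_weight_le_hweight d (k : d.-tuple int) s : 1 / 2 <= s ->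
  mix_weight s k <= (hweight k)%:R `^ (2 * s).
Proof.
move=> s2; rewrite hweight_powR /mix_weight; apply: ler_prod => j _.
rewrite addr_ge0 ?powR_ge0//= powR_superadd//; lra.
Qed.

Lemma hweight_le_mix_weight d (k : d.-tuple int) s : 0 < s -> s <= 1 / 2 ->
  (hweight k)%:R `^ (2 * s) <= mix_weight s k.
Proof.
move=> s0 s2; rewrite hweight_powR /mix_weight; apply: ler_prod => j _.
rewrite powR_ge0/= powR_subadd//; lra.
Qed.

Lemma hweight_le_mix_weightX d (k : d.-tuple int) s : 1 / 2 <= s ->
  (hweight k)%:R `^ (2 * s) <= 2 `^ ((2 * s - 1) * d%:R) * mix_weight s k.
Proof.
move=> s2; rewrite hweight_powR /mix_weight powRrM powR_mulrn ?powR_ge0//.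
rewrite -[d in _ ^+ d]card_ord -prodr_const -big_split/=; apply: ler_prod => j _.
rewrite powR_ge0/= powR_convex_half//; lra.
Qed.

Lemma mix_weight_le_hweightX d (k : d.-tuple int) s : 0 < s -> s <= 1 / 2 ->
  mix_weight s k <= 2 `^ ((1 - 2 * s) * d%:R) * (hweight k)%:R `^ (2 * s).
Proof.
move=> s0 s2; rewrite hweight_powR /mix_weight powRrM powR_mulrn ?powR_ge0//.
rewrite -[d in _ ^+ d]card_ord -prodr_const -big_split/=; apply: ler_prod => j _.
rewrite addr_ge0 ?powR_ge0//= powR_concave_half//; lra.
Qed.

Lemma powR_sqr x s : (x `^ s) ^+ 2 = x `^ (2 * s).
Proof. by rewrite mulrC powRrM powR_mulrn ?powR_ge0. Qed.

Lemma powRV x s : 0 < x -> x^-1 `^ s = (x `^ s)^-1.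
Proof.
move=> x0; apply: (mulfI (lt0r_neq0 (powR_gt0 s x0))).
by rewrite divff ?gt_eqF ?powR_gt0// -powRM ?invr_ge0 ?ltW// divff ?gt_eqF// powR1.
Qed.

Lemma powR_rate (a y N : R) m s : 0 <= a -> 0 <= y -> 0 < N ->
  a `^ s * (y `^ (m%:R * s) / N `^ s) = (a * y ^+ m / N) `^ s.
Proof.
move=> a0 y0 N0; rewrite powRrM powR_mulrn// -powRV//.
have Ni : 0 <= N^-1 by rewrite invr_ge0 ltW.
by rewrite mulrA -!powRM ?mulr_ge0 ?exprn_ge0.
Qed.

(** The factor [2 ^ ((2 s - 1) d)] is the one in [hweight_le_mix_weightX] and the inverse of the one
    in [mix_weight_le_hweightX]. This accounts for the prefactor [2 ^ (- d / 2)] in the theorem. *)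
Lemma two_rate_sqr d s r : 0 < r ->
  (2 `^ (- (d%:R / 2)) * (2 ^+ d / r) `^ s) ^+ 2 =
  2 `^ ((2 * s - 1) * d%:R) / r `^ (2 * s).
Proof.
move=> r0; rewrite exprMn !powR_sqr powRM ?exprn_ge0 ?invr_ge0 ?(ltW r0)// powRV//.
rewrite mulrA -powR_mulrn// -powRrM -powRD ?pnatr_eq0 ?implybT//.
by congr (2 `^ _ / _); field.
Qed.

End weights.

(** * Density of trigonometric polynomials *)

Section L2_closure.
Context d (T : measurableType d) (R : realType).
Variable mu : {measure set T -> \bar R}.
Implicit Types (u v w p : T -> R) (A : set (T -> R)).

Definition sqdist u v : \bar R := (\int[mu]_x ((u x - v x) ^+ 2)%:E)%E.

(** Functions are real valued because real and imaginary parts will be approximated separately. The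
    distance is an extended real, so its finiteness is part of the strict inequality. *)
Definition L2_closure A : set (T -> R) := [set u | measurable_fun setT u /\
  forall e : R, 0 < e -> exists2 p, A p & (sqdist u p < e%:E)%E].

Let msq u v : measurable_fun setT u -> measurable_fun setT v ->
  measurable_fun setT (fun x => ((u x - v x) ^+ 2)%:E).
Proof.
by move=> mu' mv; apply/measurable_EFinP/measurable_funX/measurable_funB.
Qed.

(** Integrating [(a + b)^2 <= 2 a^2 + 2 b^2] gives a substitute for the triangle inequality that
    stays with squared distances. *)
Lemma sqdist_le2 u v w : measurable_fun setT u -> measurable_fun setT v ->
  measurable_fun setT w ->
  (sqdist u w <= 2%:E * sqdist u v + 2%:E * sqdist v w)%E.
Proof.
move=> mu' mv mw; rewrite /sqdist.
rewrite -!ge0_integralZl_EFin//; [|by move=> x _; rewrite lee_fin sqr_ge0|exact: msq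
  |by move=> x _; rewrite lee_fin sqr_ge0|exact: msq].
rewrite -ge0_integralD//; last 4 first.
- by move=> x _; rewrite -EFinM lee_fin mulr_ge0// sqr_ge0.
- by apply: measurable_funeM; exact: msq.
- by move=> x _; rewrite -EFinM lee_fin mulr_ge0// sqr_ge0.
- by apply: measurable_funeM; exact: msq.
apply: ge0_le_integral => //.
- by move=> x _; rewrite lee_fin sqr_ge0.
- exact: msq.
- by apply: emeasurable_funD; apply: measurable_funeM; exact: msq.
move=> x _; rewrite -!EFinM -EFinD lee_fin.
by have := sqr_ge0 ((u x - v x) - (v x - w x)); rewrite !expr2; lra.
Qed.

Lemma sqdist_xx u : sqdist u u = 0.
Proof. by apply: integral0_eq => x _; rewrite subrr expr0n. Qed.

Lemma subset_L2_closure A : A `<=` [set u | measurable_fun setT u] ->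
  A `<=` L2_closure A.
Proof.
move=> mA u Au; split; first exact: mA.
by move=> e e0; exists u; rewrite ?sqdist_xx ?lte_fin.
Qed.

Lemma L2_closure_idem A : A `<=` [set u | measurable_fun setT u] ->
  L2_closure (L2_closure A) `<=` L2_closure A.
Proof.
move=> mA u [mu' h]; split=> // e e0.
have e4 : 0 < e / 4 by lra.
have [v [mv hv] uv] := h _ e4.
have [p Ap vp] := hv _ e4; exists p => //.
apply: le_lt_trans (sqdist_le2 mu' mv (mA _ Ap)) _.
apply: (@lt_le_trans _ _ (2%:E * (e / 4)%:E + 2%:E * (e / 4)%:E)%E).
  by apply: lteD; rewrite lte_pmul2l.
by rewrite -!EFinM -EFinD lee_fin; lra.
Qed.

(** Dominated convergence of the squared differences places [u] in the closure of the closure. *)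
Lemma L2_closure_dominated A (u_ : (T -> R)^nat) u g :
  A `<=` [set u | measurable_fun setT u] ->
  (forall n, L2_closure A (u_ n)) -> measurable_fun setT u ->
  {ae mu, forall x, u_ ^~ x @ \oo --> u x} ->
  mu.-integrable setT (EFin \o g) ->
  {ae mu, forall x n, (u x - u_ n x) ^+ 2 <= g x} ->
  L2_closure A u.
Proof.
move=> mA Au mu' cu ig ug; apply: L2_closure_idem => //; split=> // e e0.
have mun n : measurable_fun setT (u_ n) by case: (Au n).
have cvg0 : {ae mu, forall x, setT x ->
    (fun n => ((u x - u_ n x) ^+ 2)%:E) @ \oo --> (cst 0%E : T -> \bar R) x}.
  apply: filterS cu => x ux _; apply: (@cvg_EFin R nat \oo _ _ 0) => //=.
    exact: nearW.
  have d0 : (fun n => u x - u_ n x) @ \oo --> 0.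
    by rewrite -(subrr (u x)); apply: cvgB => //; exact: cvg_cst.
  have dd : (fun n => (u x - u_ n x) * (u x - u_ n x)) @ \oo --> 0.
    by rewrite -[X in _ --> X](mulr0 0); exact: cvgM.
  exact: dd.
have dom : {ae mu, forall x n, setT x -> (`|((u x - u_ n x) ^+ 2)%:E| <= (g x)%:E)%E}.
  by apply: filterS ug => x ux n _; rewrite gee0_abs ?lee_fin ?sqr_ge0 ?ux.
have [_ _ H] := dominated_convergence measurableT
  (fun n => msq mu' (mun n)) (measurable_cst _) cvg0 ig dom.
move: H; rewrite integral0 => /(_ [set y | (y < e%:E)%E]) [|N _ /(_ N (leqnn N)) h].
  by apply: open_ereal_lt'; rewrite lte_fin.
by exists (u_ N).
Qed.

Lemma L2_closure_lin A a u v :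
  A `<=` [set u | measurable_fun setT u] ->
  (forall b p q, A p -> A q -> A (fun x => b * p x + q x)) ->
  L2_closure A u -> L2_closure A v -> L2_closure A (fun x => a * u x + v x).
Proof.
move=> mA linA [mu' hu] [mv hv]; split.
  by apply: measurable_funD => //; exact: measurable_funM.
(* The two errors add up to at most [2 (a^2 + 1) e / c + 2 e / c <= e]; the summand 1 keeps the
   first estimate strict when [a = 0]. *)
move=> e e0; pose c := 4 * (a ^+ 2 + 1).
have c0 : 0 < c by rewrite mulr_gt0// ltr_pwDr// sqr_ge0.
have ec : 0 < e / c by rewrite divr_gt0.
have [p Ap up] := hu _ ec; have [q Aq vq] := hv _ ec.
exists (fun x => a * p x + q x); first exact: linA.
have mp := mA _ Ap; have mq := mA _ Aq.
have map : measurable_fun setT (fun x => a * p x) by exact: measurable_funM.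
have mau : measurable_fun setT (fun x => a * u x) by exact: measurable_funM.
apply: le_lt_trans (@sqdist_le2 _ (fun x => a * p x + v x) _ _ _ _) _.
- exact: measurable_funD.
- exact: measurable_funD.
- exact: measurable_funD.
have -> : sqdist (fun x => a * u x + v x) (fun x => a * p x + v x) =
    ((a ^+ 2)%:E * sqdist u p)%E.
  rewrite /sqdist -ge0_integralZl_EFin ?sqr_ge0//; last 2 first.
  - by move=> x _; rewrite lee_fin sqr_ge0.
  - exact: msq.
  by apply: eq_integral => x _; rewrite -EFinM; congr EFin; ring.
have -> : sqdist (fun x => a * p x + v x) (fun x => a * p x + q x) = sqdist v q.
  by apply: eq_integral => x _; congr EFin; ring.
apply: (@lt_le_trans _ _ (2%:E * ((a ^+ 2 + 1)%:E * (e / c)%:E) + 2%:E * (e / c)%:E)%E).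
  apply: lteD; last by rewrite lte_pmul2l.
  rewrite lte_pmul2l//; apply: (@le_lt_trans _ _ ((a ^+ 2)%:E * (e / c)%:E)%E).
    by apply: lee_wpmul2l; rewrite ?lee_fin ?sqr_ge0// ltW.
  by rewrite -!EFinM lte_fin ltr_pM2r// ltrDl.
rewrite -!EFinM -EFinD lee_fin.
rewrite mulrA -mulrDl mulrA ler_pdivrMr// [leRHS]mulrC ler_pM2r// /c.
by have := sqr_ge0 a; lra.
Qed.

End L2_closure.

(** * From indicators of a pi-system to square-integrable functions *)

Section L2_dense.
Context d (T : measurableType d) (R : realType).
Variable mu : {finite_measure set T -> \bar R}.
Variable A : set (T -> R).
Hypothesis mA : A `<=` [set u | measurable_fun setT u].
Hypothesis A0 : A (cst 0).
Hypothesis linA : forall (b : R) p q, A p -> A q -> A (fun x => b * p x + q x).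

Let clA := L2_closure mu A.

Let clA_lin a u v : clA u -> clA v -> clA (fun x => a * u x + v x).
Proof. exact: L2_closure_lin. Qed.

Let clA0 : clA (cst 0).
Proof. exact: subset_L2_closure. Qed.

Lemma integrable_cst_fin (c : R) : mu.-integrable setT (EFin \o cst c).
Proof.
apply: measurable_bounded_integrable => //.
- by have := fin_num_measure mu _ (@measurableT _ T); rewrite fin_numElt => /andP[].
- exists `|c|; split => // M cM x _ /=; exact: ltW.
Qed.

(** The sets with indicator in the closure form a Dynkin class: complements come from linearity and
    the constant 1, disjoint unions from dominated convergence of the partial sums, which lie
    between 0 and 1. *)
Lemma L2_closure_indic (G : set (set T)) :
  @measurable _ T = <<s G >> -> setI_closed G -> clA (cst 1) ->
  (forall B, G B -> clA \1_B) -> forall B, measurable B -> clA \1_B.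
Proof.
move=> GE GI cl1 clG B mB; rewrite GE in mB; move: B mB.
apply: (dynkin_induction GE GI) => //.
- by rewrite indicT.
- move=> S mS clS.
  rewrite (_ : \1_(~` S) = fun x => -1 * \1_S x + cst 1 x); first exact: clA_lin.
  apply/funext => x; rewrite !indicE in_setC; case: (x \in S) => /=; ring.
move=> F mF tF clF; apply: (@L2_closure_dominated _ _ _ _ _
    (fun n x => \sum_(i < n) \1_(F i) x) _ (cst 1)) => //.
- elim=> [|n IH].
    rewrite (_ : (fun x => _) = cst 0)//.
    by apply/funext => x; rewrite big_ord0.
  rewrite (_ : (fun x => _) = fun x => 1 * \1_(F n) x + \sum_(i < n) \1_(F i) x).
    exact: clA_lin.
  by apply/funext => x; rewrite big_ord_recr/= mul1r addrC.
- by apply: measurable_indic; exact: bigcup_measurable.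
- apply: aeW => x; have [xF|xF] := pselect ((\bigcup_k F k) x).
    rewrite indicE mem_set//; case: xF => k _ Fkx.
    apply: cvg_near_cst; exists k.+1 => // n /= kn.
    rewrite (bigD1 (Ordinal kn))//= indicE mem_set// big1 ?addr0// => i ik.
    rewrite indicE memNset// => Fix; move/eqP: ik; apply; apply/val_inj => /=.
    by apply: tF => //; exists x.
  rewrite indicE memNset//; apply: cvg_near_cst; apply: nearW => n.
  rewrite big1// => i _; rewrite indicE memNset// => Fix.
  by apply: xF; exists i.
- exact: integrable_cst_fin.
apply: aeW => x n /=.
have : 0 <= (\sum_(i < n) \1_(F i) x : R) <= \1_(\bigcup_k F k) x.
  rewrite sumr_ge0//=; have [[i Fix]|h] := pselect (exists i : 'I_n, F i x).
    rewrite (bigD1 i)//= indicE mem_set// big1 ?addr0.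
      by rewrite indicE mem_set//; exists i.
    move=> j ij; rewrite indicE memNset// => Fjx; move/eqP: ij; apply; apply/val_inj.
    by apply: tF => //; exists x.
  by rewrite big1// => i _; rewrite indicE memNset// => Fix; apply: h; exists i.
have : 0 <= (\1_(\bigcup_k F k) x : R) <= 1.
  by rewrite indicE; case: (_ \in _); rewrite ?lexx ler01.
by move=> /andP[a b] /andP[e f]; rewrite expr2 -[leRHS]mulr1 ler_pM//; lra.
Qed.

Import HBNNSimple.

(** Linearity gives simple functions. A nonnegative [u] is a limit of simple functions below it,
    with squared error dominated by [u ^ 2]; a general [u] is the difference of its positive and
    negative parts. *)
Lemma L2_closure_full : (forall B, measurable B -> clA \1_B) ->
  forall u : T -> R, measurable_fun setT u ->
    mu.-integrable setT (EFin \o (fun x => u x ^+ 2)) -> clA u.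
Proof.
move=> clB.
have clsf (f : {nnsfun T >-> R}) : clA f.
  rewrite (_ : f = (fun x => \sum_(y <- finmap.enum_fset (fset_set (range f))) y * \1_(f @^-1` [set y]) x) :> (T -> R)).
    elim: (X in fun x => \sum_(y <- X) _) => [|y s IH].
      rewrite (_ : (fun x => _) = cst 0)//.
      by apply/funext => x; rewrite big_nil.
    rewrite (_ : (fun x => _) = fun x => y * \1_(f @^-1` [set y]) x +
      \sum_(y <- s) y * \1_(f @^-1` [set y]) x).
      by apply: clA_lin => //; exact: clB.
    by apply/funext => x; rewrite big_cons.
  by apply/funext => x; rewrite [LHS]fimfunE fsbig_finite.
have clpos (u : T -> R) : measurable_fun setT u -> (forall x, 0 <= u x) ->
    mu.-integrable setT (EFin \o (fun x => u x ^+ 2)) -> clA u.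
  move=> mu' u0 iu.
  have mEu : measurable_fun setT (EFin \o u) by exact/measurable_EFinP.
  apply: (@L2_closure_dominated _ _ _ _ _
    (fun n => nnsfun_approx measurableT mEu n) _ (fun x => u x ^+ 2)) => //.
  - by move=> n; exact: clsf.
  - apply: aeW => x; have := @cvg_nnsfun_approx _ _ _ _ measurableT _ mEu
       (fun x _ => u0 x) x I.
    by move=> /fine_cvgP[_].
  apply: aeW => x n.
  have f0 : 0 <= nnsfun_approx measurableT mEu n x by [].
  have fu : nnsfun_approx measurableT mEu n x <= u x.
    rewrite nnsfun_approxE -lee_fin; apply: le_approx => // y _.
    by rewrite lee_fin.
  by apply: lerXn2r; rewrite ?nnegrE ?subr_ge0//; lra.
move=> u mu' iu.
have mpos (f : T -> R) : measurable_fun setT f -> measurable_fun setT (fun x => Num.max (f x) 0).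
  by move=> mf; exact: measurable_maxr.
have mN : measurable_fun setT (fun x => - u x) by exact: measurableT_comp.
have ipos (f : T -> R) : measurable_fun setT f -> (forall x, f x ^+ 2 = u x ^+ 2) ->
    mu.-integrable setT (EFin \o (fun x => (Num.max (f x) 0) ^+ 2)).
  move=> mf fu; apply: le_integrable iu => //.
    by apply/measurable_EFinP/measurable_funX/mpos.
  move=> x _ /=; rewrite lee_fin !ger0_norm ?sqr_ge0// -fu.
  by case: (leP (f x) 0) => h; rewrite ?expr0n ?sqr_ge0.
rewrite (_ : u = fun x => -1 * Num.max (- u x) 0 + Num.max (u x) 0); last first.
  apply/funext => x; case: (leP (u x) 0) => h.
    by rewrite max_l ?oppr_ge0//; ring.
  by rewrite max_r ?oppr_le0 ?ltW//; ring.
apply: clA_lin; apply: clpos.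
- exact: mpos.
- by move=> x; rewrite le_max lexx orbT.
- by apply: ipos => // x; rewrite sqrrN.
- exact: mpos.
- by move=> x; rewrite le_max lexx orbT.
- exact: ipos.
Qed.

End L2_dense.

Section null_cylinders.
Context d (T : measurableType d) (R : realType).

(** Either the first coordinate or one of the rest is constrained, so the cylinder is a rectangle
    with a null side. *)
Lemma tuple_measure_cylinder0 (mu : {finite_measure set T -> \bar R}) n (j : 'I_n)
    (N : set T) : measurable N -> mu N = 0%E ->
  tuple_measure mu n [set x | N (tnth x j)] = 0%E.
Proof.
move=> mN N0; elim: n j => [[]//|n IH] j /=.
have mS (k : 'I_n) : measurable [set x : n.-tuple T | N (tnth x k)].
  by rewrite -[X in measurable X]setTI; exact: (measurable_tnth k).
rewrite /cons_measure /pushforward; have [k ->|->] := unliftP ord0 j.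
  rewrite (_ : _ @^-1` _ = setT `*` [set x | N (tnth x k)]); last first.
    by apply/seteqP; split => -[x t] /=; rewrite tnthS//; case.
  rewrite (product_measure1E _ _ measurableT (mS k)) -[RHS](mule0 (mu setT)).
  by congr (_ * _)%E; exact: IH.
rewrite (_ : _ @^-1` _ = N `*` setT); last first.
  by apply/seteqP; split => -[x t] /=; rewrite tnth0//; case.
rewrite product_measure1E// -[RHS](mul0e (tuple_measure mu n setT)).
by congr (_ * _)%E.
Qed.

Lemma ae_tuple (mu : {finite_measure set T -> \bar R}) n (j : 'I_n) (P : set T) :
  (\forall x \ae mu, P x) -> \forall x \ae tuple_measure mu n, P (tnth x j).
Proof.
move=> [N [mN N0 PN]]; exists [set x | N (tnth x j)]; split.
- by rewrite -[X in measurable X]setTI; exact: (measurable_tnth j).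
- exact: tuple_measure_cylinder0.
- by move=> x /= h; exact: PN.
Qed.

End null_cylinders.

Section torus_ae.
Variable R : realType.
Local Notation circle := (circle_measure R).

Lemma circle_measure_set1 (a : R) : circle [set a] = 0%E.
Proof.
apply/eqP; rewrite -measure_le0 -(lebesgue_measure_set1 a).
by apply: le_measure; rewrite ?inE//; apply: measurableI => //; exact: measurable_itv.
Qed.

Lemma ae_circle_itv : \forall y \ae circle, 0 < y < 2 * pi.
Proof.
exists (~` `]0, 2 * pi[); split.
- by apply: measurableC; exact: measurable_itv.
- change (lebesgue_measure (~` `]0, (2 * pi : R)[ `&` `[0, 2 * pi]) = 0%E).
  apply/eqP; rewrite -measure_le0.
  rewrite (@le_trans _ _ (lebesgue_measure ([set 0] `|` [set 2 * pi : R])))//.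
    apply: le_measure; rewrite ?inE//.
    - by apply: measurableI; [apply: measurableC|]; exact: measurable_itv.
    - exact: measurableU.
    move=> y [/= h]; rewrite !in_itv/= in h * => /andP[y0 y1].
    have [->|yn0] := eqVneq y 0; first by left.
    right; apply/eqP; apply: contrapT => /negP yn1; apply: h.
    by rewrite !lt_neqAle eq_sym yn0 y0 yn1.
  apply: (le_trans (measureU2 _ _ _)) => //.
  change (lebesgue_measure [set 0%R : R] + lebesgue_measure [set (2 * pi)%R : R] <= 0)%E.
  by rewrite !lebesgue_measure_set1 adde0.
- by move=> y /= h; rewrite in_itv/=.
Qed.

Lemma ae_circle_neq (a : R) : \forall y \ae circle, y != a.
Proof.
exists [set a]; split; [exact: measurable_set1|exact: circle_measure_set1|].
by move=> y /= /negP; rewrite negbK => /eqP.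
Qed.

End torus_ae.

(** * Polynomial approximation of arcs of the circle *)

Section step_polynomials.
Variable R : realType.
Implicit Types t y : R.

(* The Brosowski-Deutsch polynomials: on [0, 1] they converge to 1 below 1/2 and to 0
   above 1/2. *)
Definition step_poly (n : nat) t : R := (1 - t ^+ n) ^+ (2 ^ n).

Lemma bernoulli_add y N : 0 <= y -> 1 + N%:R * y <= (1 + y) ^+ N.
Proof.
move=> y0; case: N => [|N]; first by rewrite mul0r addr0.
have y1 : 1 <= 1 + y by lra.
have := exprB_ge N (@ler01 R) y1.
rewrite !expr1n mulr1 addrAC subrr add0r; lra.
Qed.

Lemma bernoulli_sub y N : 0 <= y <= 1 -> 1 - N%:R * y <= (1 - y) ^+ N.
Proof.
move=> /andP[y0 y1]; case: N => [|N]; first by rewrite mul0r subr0.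
have y1' : 0 <= 1 - y by lra.
have y1'' : 1 - y <= 1 by lra.
have := exprB_le N y1' y1''.
rewrite !expr1n mulr1 opprB addrCA subrr addr0; lra.
Qed.

Lemma step_poly_itv n t : 0 <= t <= 1 -> 0 <= step_poly n t <= 1.
Proof.
move=> /andP[t0 t1]; have tn : 0 <= t ^+ n <= 1 by rewrite exprn_ge0//= exprn_ile1.
by rewrite /step_poly exprn_ge0 ?exprn_ile1//; lra.
Qed.

(** By Bernoulli's inequality, [(1 - t^n)^(2^n) >= 1 - (2 t)^n], and [2 t < 1]. *)
Lemma cvg_step_poly1 t : 0 <= t -> t < 1 / 2 -> step_poly n t @[n --> \oo] --> (1 : R).
Proof.
move=> t0 t2; have t01 : 0 <= t <= 1 by lra.
apply: (@squeeze_cvgr _ _ _ _ (fun n => 1 - (2 * t) ^+ n) (cst 1)); last 2 first.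
- rewrite -[X in _ --> X]subr0; apply: cvgB; first exact: cvg_cst.
  by apply: cvg_expr; rewrite ger0_norm; lra.
- exact: cvg_cst.
apply: nearW => n; have /andP[_ ->] := step_poly_itv n t01; rewrite andbT.
apply: le_trans (bernoulli_sub (2 ^ n) _).
  by rewrite natrX exprMn.
by rewrite exprn_ge0//= exprn_ile1//; lra.
Qed.

(** With [y = t^n] and [N = 2^n], the product [(1 - y)^N (1 + y)^N] is at most 1, while
    [(1 + y)^N >= (2 t)^n] by Bernoulli's inequality; so the polynomial is at most [(2 t)^(-n)]. *)
Lemma cvg_step_poly0 t : 1 / 2 < t -> t <= 1 -> step_poly n t @[n --> \oo] --> (0 : R).
Proof.
move=> t2 t1; have t01 : 0 <= t <= 1 by lra.
apply: (@squeeze_cvgr _ _ _ _ (cst 0) (fun n => (2 * t)^-1 ^+ n)); last 2 first.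
- exact: cvg_cst.
- apply: cvg_expr; rewrite ger0_norm ?invr_ge0; last lra.
  by rewrite invf_lt1; lra.
apply: nearW => n; have /andP[-> p1] := step_poly_itv n t01.
have p0 : 0 < (2 * t) ^+ n by rewrite exprn_gt0//; lra.
rewrite exprVn -[leRHS]mul1r ler_pdivlMr//= /step_poly.
have y01 : 0 <= t ^+ n <= 1 by rewrite exprn_ge0 ?exprn_ile1//; lra.
have := @bernoulli_add (t ^+ n) (2 ^ n).
rewrite natrX -exprMn => /(_ ltac:(by case/andP : y01)) h.
apply: (@le_trans _ _ ((1 - t ^+ n) ^+ (2 ^ n) * (1 + t ^+ n) ^+ (2 ^ n))).
  by apply: ler_wpM2l; [apply: exprn_ge0; lra|lra].
rewrite -exprMn; apply: exprn_ile1.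
  by apply: mulr_ge0; lra.
rewrite (_ : _ * _ = 1 - (t ^+ n) ^+ 2); last by ring.
by have := sqr_ge0 (t ^+ n); lra.
Qed.

(* 1/2 - (cos (y - a/2) - cos (a/2)) / 4 lies below 1/2 exactly on the arc ]0, a[,
   as cos (y - a/2) - cos (a/2) = 2 sin (y/2) sin ((a - y)/2). *)
Definition arc_fun (a : \bar R) (y : R) : R :=
  if (a <= 0)%E then 1 else if ((2 * pi)%:E <= a)%E then 0 else
  1 / 2 - (cos (y - fine a / 2) - cos (fine a / 2)) / 4.

Lemma arc_fun_itv a y : 0 <= arc_fun a y <= 1.
Proof.
rewrite /arc_fun; case: ifP => _; first by rewrite ler01 lexx.
case: ifP => _; first by rewrite ler01 lexx.
have := cos_geN1 (y - fine a / 2); have := cos_le1 (y - fine a / 2).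
have := cos_geN1 (fine a / 2); have := cos_le1 (fine a / 2).
by move: (cos _) (cos _) => u v; lra.
Qed.

(** The point [y = a] has to be excluded: there [arc_fun] takes the value 1/2, at which the step
    polynomials tend to [1 / e]. *)
Lemma cvg_step_arc (a : \bar R) y : 0 < y < 2 * pi -> y%:E != a ->
  step_poly n (arc_fun a y) @[n --> \oo] --> ((y%:E < a)%E%:R : R).
Proof.
move=> /andP[y0 y2] ya; have /andP[t0 t1] := arc_fun_itv a y.
have [ya'|ay] := ltP y%:E a.
  apply: cvg_step_poly1 => //; rewrite /arc_fun ifF; last first.
    by apply/negbTE; rewrite -ltNge; apply: lt_trans ya'; rewrite lte_fin.
  case: ifPn => [_|]; first lra.
  rewrite -ltNge => a2.
  case: a ya ya' a2 t0 t1 => [a| |]// _; rewrite !lte_fin /= => ya' a2 _ _.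
  have -> : cos (y - a / 2) - cos (a / 2) = 2 * (sin (y / 2) * sin ((a - y) / 2)).
    have -> : y - a / 2 = y / 2 - (a - y) / 2 by field.
    have -> : a / 2 = y / 2 + (a - y) / 2 by field.
    by rewrite cosB cosD; ring.
  have s1 : 0 < sin (y / 2) by apply: sin_gt0_pi; apply/andP; split; lra.
  have s2 : 0 < sin ((a - y) / 2) by apply: sin_gt0_pi; apply/andP; split; lra.
  by have := mulr_gt0 s1 s2; lra.
have {ay}ay : (a < y%:E)%E by rewrite lt_neqAle eq_sym ya.
apply: cvg_step_poly0 => //; rewrite /arc_fun; case: ifPn => [_|]; first lra.
rewrite -ltNge => a0; rewrite ifF; last first.
  by apply/negbTE; rewrite -ltNge; apply: lt_trans ay _; rewrite lte_fin.
case: a ya ay a0 t0 t1 => [a| |]// _; rewrite !lte_fin /= => ay a0 _ _.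
have -> : cos (y - a / 2) - cos (a / 2) = - (2 * (sin (y / 2) * sin ((y - a) / 2))).
  have -> : y - a / 2 = y / 2 + (y - a) / 2 by field.
  have -> : a / 2 = y / 2 - (y - a) / 2 by field.
  by rewrite cosB cosD; ring.
have s1 : 0 < sin (y / 2) by apply: sin_gt0_pi; apply/andP; split; lra.
have s2 : 0 < sin ((y - a) / 2) by apply: sin_gt0_pi; apply/andP; split; lra.
by have := mulr_gt0 s1 s2; lra.
Qed.

End step_polynomials.

(** * Trigonometric polynomials and boxes *)

Section trig_poly.
Variables (R : realType) (d : nat).
Local Notation T := (d.-tuple (measurableTypeR R)).
Local Notation mu := (torus_measure R d).
Implicit Types (k : d.-tuple int) (p q : T -> R).

(** Products are built in, so that step polynomials of arc functions qualify without computation;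
    [trig_poly_span] later expands them into sums of exponentials. *)
Inductive trig_poly : (T -> R) -> Prop :=
| trig_poly_cst c : trig_poly (cst c)
| trig_poly_cos k : trig_poly (fun x => cos (dotk k x))
| trig_poly_sin k : trig_poly (fun x => sin (dotk k x))
| trig_polyD p q : trig_poly p -> trig_poly q -> trig_poly (fun x => p x + q x)
| trig_polyM p q : trig_poly p -> trig_poly q -> trig_poly (fun x => p x * q x).

Lemma measurable_dotk k : measurable_fun [set: T] (dotk k : T -> R).
Proof.
apply: measurable_sum => j.
by apply: measurable_funM => //; exact: measurable_tnth.
Qed.

Lemma measurable_trig_poly p : trig_poly p -> measurable_fun [set: T] p.
Proof.
elim=> [c|k|k|{}p q _ mp _ mq|{}p q _ mp _ mq].
- exact: measurable_cst.
- apply: (measurableT_comp _ (measurable_dotk k)).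
  by apply: continuous_measurable_fun; exact: continuous_cos.
- apply: (measurableT_comp _ (measurable_dotk k)).
  by apply: continuous_measurable_fun; exact: continuous_sin.
- exact: measurable_funD.
- exact: measurable_funM.
Qed.

Lemma trig_polyX p n : trig_poly p -> trig_poly (fun x => p x ^+ n).
Proof.
move=> tp; elim: n => [|n IH].
  by rewrite (_ : (fun x => _) = cst 1)//; exact: trig_poly_cst.
rewrite (_ : (fun x => _) = fun x => p x * p x ^+ n); first exact: trig_polyM.
by apply/funext => x; rewrite exprS.
Qed.

Lemma trig_polyB p q : trig_poly p -> trig_poly q -> trig_poly (fun x => p x - q x).
Proof.
move=> tp tq; rewrite (_ : (fun x => _) = fun x => p x + (cst (-1) x * q x)).
  by apply: trig_polyD => //; apply: trig_polyM => //; exact: trig_poly_cst.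
by apply/funext => x; rewrite mulN1r.
Qed.

Lemma trig_poly_prod (I : Type) (s : seq I) (F : I -> T -> R) :
  (forall i, trig_poly (F i)) -> trig_poly (fun x => \prod_(i <- s) F i x).
Proof.
move=> tF; elim: s => [|i s IH].
  rewrite (_ : (fun x => _) = cst 1); first exact: trig_poly_cst.
  by apply/funext => x; rewrite big_nil.
rewrite (_ : (fun x => _) = fun x => F i x * \prod_(j <- s) F j x).
  exact: trig_polyM.
by apply/funext => x; rewrite big_cons.
Qed.

Definition unit_freq (j : 'I_d) : d.-tuple int := [tuple (i == j)%:Z | i < d].

Lemma dotk_unit_freq j (x : d.-tuple R) : dotk (unit_freq j) x = tnth x j.
Proof.
rewrite /dotk (bigD1 j)//= big1 ?addr0; first by rewrite tnth_mktuple eqxx mul1r.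
by move=> i /negbTE ij; rewrite tnth_mktuple ij mul0r.
Qed.

Lemma trig_poly_arc (a : \bar R) j : trig_poly (fun x => arc_fun a (tnth x j)).
Proof.
rewrite /arc_fun; case: (a <= 0)%E; first exact: trig_poly_cst.
case: ((2 * pi)%:E <= a)%E; first exact: trig_poly_cst.
set b := fine a / 2.
rewrite (_ : (fun x => _) = fun x => cst (1 / 2) x -
  ((cos (dotk (unit_freq j) x) * cst (cos b) x + sin (dotk (unit_freq j) x) * cst (sin b) x)
   - cst (cos b) x) * cst (4^-1) x).
  apply: trig_polyB; first exact: trig_poly_cst.
  apply: trig_polyM; last exact: trig_poly_cst.
  apply: trig_polyB; last exact: trig_poly_cst.
  by apply: trig_polyD; apply: trig_polyM; by [exact: trig_poly_cst|
    exact: trig_poly_cos|exact: trig_poly_sin].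
by apply/funext => x; rewrite dotk_unit_freq cosB.
Qed.

(** Orthants with extended real corners: taking minima of corners gives intersections, and entries
    [+oo] leave coordinates free, so that a half-space in one coordinate is a box. *)
Definition box (a : 'I_d -> \bar R) : set T :=
  [set x | forall j, ((tnth x j)%:E < a j)%E].

Definition boxes : set (set T) := range box.

Lemma setI_closed_boxes : setI_closed boxes.
Proof.
move=> _ _ [a _ <-] [b _ <-]; exists (fun j => Order.min (a j) (b j)) => //.
apply/seteqP; split => x /=.
  by move=> h; split => j; have := h j; rewrite lt_min => /andP[].
by move=> [h1 h2] j; rewrite lt_min h1 h2.
Qed.

Lemma measurable_box a : measurable (box a).
Proof.
rewrite (_ : box a = \bigcap_(j in [set: 'I_d]) [set x | ((tnth x j)%:E < a j)%E]); last first.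
  by apply/seteqP; split => x /= h j; [move=> _; exact: h|exact: (h j I)].
apply: fin_bigcap_measurable => // j _.
have m1 : measurable_fun [set: T] (fun x => (tnth x j)%:E : \bar R).
  by apply/measurable_EFinP; exact: measurable_tnth.
by rewrite -[X in measurable X]setTI; exact: emeasurable_fun_infty_o.
Qed.

(** The identity from the sigma-algebra generated by the boxes is measurable as soon as each
    coordinate is, and the preimage of an open ray under a coordinate is a box. *)
Lemma measurable_boxesE : @measurable _ T = <<s boxes >>.
Proof.
apply/seteqP; split; last first.
  apply: smallest_sub; first exact: sigma_algebra_measurable.
  by move=> _ [a _ <-]; exact: measurable_box.
move=> S mS.
have mid : measurable_fun [set: g_sigma_algebraType boxes] (id : g_sigma_algebraType boxes -> T).
  apply/measurable_fun_tnthP => j.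
  apply: (measurability _ (RGenInftyO.measurableE R)).
  move=> _ [_ [y ->] <-]; rewrite setTI; apply: sub_sigma_algebra.
  exists (fun i => if i == j then y%:E else +oo%E) => //.
  apply/seteqP; split => x /=.
    by move=> /(_ j); rewrite eqxx in_itv.
  by rewrite in_itv/= => xy i; case: eqVneq => [->|_]; rewrite ?lte_fin ?ltry.
by have := mid measurableT _ mS; rewrite setTI.
Qed.

Lemma L2_closure_box a : L2_closure mu trig_poly \1_(box a).
Proof.
have sub : trig_poly `<=` [set u | measurable_fun [set: T] u].
  by move=> p; exact: measurable_trig_poly.
have FF : Filter (nbhs (almost_everywhere mu)) by exact: ae_filter_ringOfSetsType.
pose p n (x : T) : R := \prod_(j < d) step_poly n (arc_fun (a j) (tnth x j)).
(* The exceptional points have a coordinate 0 or [2 pi], or lie on the hyperplane of a face of the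
   box; elsewhere every factor of [p n x] converges. *)
have good : \forall x \ae mu, forall j, 0 < tnth x j < 2 * pi /\ (tnth x j)%:E != a j.
  apply: filter_forall => j; apply: (ae_tuple (mu := circle_measure R) j (P :=
    [set y | 0 < y < 2 * pi /\ y%:E != a j])).
  have FF' : Filter (nbhs (almost_everywhere (circle_measure R))).
    exact: ae_filter_ringOfSetsType.
  have h : \forall y \ae circle_measure R, y%:E != a j.
    case: (a j) => [b| |]; last 2 first.
    - exact: nearW.
    - exact: nearW.
    by apply: filterS (ae_circle_neq b) => y; rewrite eqe.
  by apply: filterS2 (ae_circle_itv R) h => y ? ?; split.
have p01 n x : 0 <= p n x <= 1.
  have h j : 0 <= step_poly n (arc_fun (a j) (tnth x j)) <= 1.
    by apply: step_poly_itv; exact: arc_fun_itv.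
  apply/andP; split; first by apply: prodr_ge0 => j _; have /andP[] := h j.
  apply: (@le_trans _ _ (\prod_(j < d) 1)); last by rewrite big1.
  by apply: ler_prod => j _; exact: h.
apply: (@L2_closure_dominated _ _ _ mu trig_poly p _ (cst 1)) => //.
- move=> n; apply: subset_L2_closure => //; apply: trig_poly_prod => j.
  apply: trig_polyX; apply: trig_polyB; first exact: trig_poly_cst.
  by apply: trig_polyX; exact: trig_poly_arc.
- by apply: measurable_indic; exact: measurable_box.
- apply: filterS good => x gx.
  have -> : \1_(box a) x = \prod_(j < d) (((tnth x j)%:E < a j)%E%:R : R).
    have [xa|xa] := pselect (box a x).
      by rewrite indicE mem_set// big1// => j _; rewrite xa.
    rewrite indicE memNset//; move/existsNP : xa => [j /negP/negbTE xj].
    by rewrite (bigD1 j)//= xj mul0r.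
  rewrite /p; elim: (index_enum _) => [|j s IH].
    by under eq_fun do rewrite big_nil; rewrite big_nil; exact: cvg_cst.
  under eq_fun do rewrite big_cons; rewrite big_cons; apply: cvgM => //.
  by have [? ?] := gx j; exact: cvg_step_arc.
- exact: integrable_cst_fin.
apply: aeW => x n /=; have /andP[a0 a1] := p01 n x.
have : 0 <= (\1_(box a) x : R) <= 1.
  by rewrite indicE; case: (_ \in _); rewrite ?lexx ler01.
move=> /andP[b0 b1]; rewrite -[1](expr1n R 2) -[leLHS]real_normK ?num_real//.
by apply: lerXn2r; rewrite ?nnegrE// ler_norml; apply/andP; split; lra.
Qed.

Theorem trig_poly_dense (u : T -> R) : measurable_fun setT u ->
  mu.-integrable setT (EFin \o (fun x => u x ^+ 2)) -> L2_closure mu trig_poly u.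
Proof.
have sub : trig_poly `<=` [set u | measurable_fun [set: T] u].
  by move=> p; exact: measurable_trig_poly.
have lin (b : R) p q : trig_poly p -> trig_poly q -> trig_poly (fun x => b * p x + q x).
  by move=> tp tq; apply: trig_polyD => //; apply: (trig_polyM (trig_poly_cst b)).
apply: (L2_closure_full sub (trig_poly_cst 0) lin).
apply: (L2_closure_indic sub (trig_poly_cst 0) lin measurable_boxesE
  setI_closed_boxes).
  by apply: subset_L2_closure => //; exact: trig_poly_cst.
by move=> _ [a _ <-]; exact: L2_closure_box.
Qed.

End trig_poly.

(** * Fourier analysis on the torus *)

Section bounded_fubini.
Context d1 d2 (T1 : measurableType d1) (T2 : measurableType d2) (R : realType).

Lemma bounded1_integrable d (T : measurableType d)
    (mu : {finite_measure set T -> \bar R}) (f : T -> R) :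
  measurable_fun setT f -> (forall x, `|f x| <= 1) ->
  mu.-integrable setT (EFin \o f).
Proof.
move=> mf f1; apply: measurable_bounded_integrable => //.
- by have := fin_num_measure mu _ (@measurableT _ T); rewrite fin_numElt => /andP[].
- exists 1; split => // M M1 x _; exact: le_trans (f1 x) (ltW M1).
Qed.

Lemma Rintegral_prod (m1 : {finite_measure set T1 -> \bar R})
    (m2 : {finite_measure set T2 -> \bar R}) (f : T1 -> R) (g : T2 -> R) :
  measurable_fun setT f -> (forall x, `|f x| <= 1) ->
  measurable_fun setT g -> (forall x, `|g x| <= 1) ->
  (m1 \x m2)%E.-integrable setT (EFin \o (fun z => f z.1 * g z.2)) /\
  \int[(m1 \x m2)%E]_z (f z.1 * g z.2) = (\int[m1]_x f x) * (\int[m2]_y g y).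
Proof.
move=> mf f1 mg g1.
have ifg : (m1 \x m2)%E.-integrable setT (EFin \o (fun z => f z.1 * g z.2)).
  apply: measurable_bounded_integrable => //.
  - change ((m1 \x m2)%E setT < +oo)%E; rewrite -setXTT product_measure1E//.
    by rewrite lte_mul_pinfty// ?fin_num_measure// ltey_eq fin_num_measure.
  - by apply: measurable_funM; apply: measurableT_comp.
  - exists 1; split => // M M1 x _ /=; apply: le_trans (ltW M1).
    by rewrite normrM mulr_ile1.
split=> //; have if1 := bounded1_integrable m1 mf f1.
have ig1 := bounded1_integrable m2 mg g1.
have fg2 : (\int[m2]_y (g y)%:E)%E \is a fin_num by exact: integrable_fin_num.
rewrite {1}/Rintegral -(integral12_prod_meas1 ifg) /=.
transitivity (fine (\int[m1]_x ((f x)%:E * \int[m2]_y (g y)%:E)))%E.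
  congr fine; apply: eq_integral => x _; rewrite /fubini_F /=.
  by under eq_integral do rewrite EFinM; rewrite integralZl.
rewrite -(fineK fg2) integralZr// fineM ?fin_numEFin//.
exact: integrable_fin_num.
Qed.

End bounded_fubini.

Section tuple_fubini.
Context d (T : measurableType d) (R : realType).

Lemma Rintegral_tuple_cons (mu : {finite_measure set T -> \bar R}) n
    (h : n.+1.-tuple T -> R) (f : T -> R) (g : n.-tuple T -> R) :
  measurable_fun setT h ->
  measurable_fun setT f -> (forall x, `|f x| <= 1) ->
  measurable_fun setT g -> (forall x, `|g x| <= 1) ->
  (forall (x : T) (t : n.-tuple T), h [tuple of x :: t] = f x * g t) ->
  \int[tuple_measure mu n.+1]_x h x =
  (\int[mu]_x f x) * (\int[tuple_measure mu n]_t g t).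
Proof.
move=> mh mf f1 mg g1 hfg.
have [ifg <-] := Rintegral_prod mu (tuple_measure mu n) mf f1 mg g1.
have hE : EFin \o h \o @cons_pair _ T n = EFin \o (fun z => f z.1 * g z.2).
  by apply/funext => z /=; rewrite hfg.
pose fg (z : T * n.-tuple T) := f z.1 * g z.2.
rewrite /Rintegral; congr fine.
change (\int[pushforward (mu \x tuple_measure mu n)%E (@cons_pair _ T n)]_x (EFin \o h) x =
  \int[(mu \x tuple_measure mu n)%E]_z (EFin \o fg) z)%E.
rewrite integral_pushforward ?preimage_setT ?hE//.
- exact: measurable_cons_pair.
- exact/measurable_EFinP.
Qed.

End tuple_fubini.

(** * Integrals of sines and cosines *)

Section circle_integrals.
Variable R : realType.
Local Notation circle := (circle_measure R).
Implicit Types f : R -> R.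

Lemma Rintegral_circle f : circle.-integrable setT (EFin \o f) ->
  \int[circle]_x f x = \int[lebesgue_measure]_(x in `[0, 2 * pi]) f x.
Proof.
move=> fi; rewrite /Rintegral; congr fine.
have mI : measurable (`[0%R, 2 * pi] : set (measurableTypeR R)).
  exact: measurable_itv.
have N0 : circle (~` `[0, 2 * pi]) = 0%E.
  change (lebesgue_measure (~` `[0, (2 * pi : R)] `&` `[0, 2 * pi]) = 0%E).
  by rewrite setICl measure0.
rewrite (negligible_integral (measurableC mI) measurableT fi N0).
rewrite setTD setCK; apply: eq_measure_integral => A mA AI.
by change (lebesgue_measure (A `&` `[0, (2 * pi : R)]) = lebesgue_measure A);
  rewrite setIidl.
Qed.

Lemma Rintegral_circle_deriv f (F : R -> R) :
  circle.-integrable setT (EFin \o f) -> continuous f ->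
  (forall x : R, is_derive x 1 F (f x)) ->
  \int[circle]_x f x = F (2 * pi) - F 0.
Proof.
move=> fi cf dF; rewrite Rintegral_circle// /Rintegral.
have cF : continuous F.
  move=> x; apply/differentiable_continuous/derivable1_diffP.
  exact: (@ex_derive _ _ _ _ _ _ _ (dF x)).
rewrite (@continuous_FTC2 R f F 0 (2 * pi))//.
- by rewrite mulr_gt0// pi_gt0.
- exact: continuous_subspaceT.
- split.
  + move=> x _; exact: (@ex_derive _ _ _ _ _ _ _ (dF x)).
  + by apply: cvg_at_right_filter; exact: cF.
  + by apply: cvg_at_left_filter; exact: cF.
- by move=> x _; rewrite derive1E (@derive_val _ _ _ _ _ _ _ (dF x)).
Qed.

Let mcos (c : R) : measurable_fun [set: measurableTypeR R] (fun x => cos (c * x) : R).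
Proof.
apply: measurableT_comp; last exact: measurable_funM.
by apply: continuous_measurable_fun; exact: continuous_cos.
Qed.

Let msin (c : R) : measurable_fun [set: measurableTypeR R] (fun x => sin (c * x) : R).
Proof.
apply: measurableT_comp; last exact: measurable_funM.
by apply: continuous_measurable_fun; exact: continuous_sin.
Qed.

Lemma cos_norm_le1 (x : R) : `|cos x| <= 1.
Proof. by rewrite ler_norml cos_geN1 cos_le1. Qed.

Lemma sin_norm_le1 (x : R) : `|sin x| <= 1.
Proof. by rewrite ler_norml sin_geN1 sin_le1. Qed.

Let cmul (c : R) : continuous (fun x : R => c * x).
Proof. by move=> x; apply: cvgM; [exact: cvg_cst|exact: cvg_id]. Qed.

Lemma cos_sin_2pi_int (z : int) : cos (z%:~R * (2 * pi)) = 1 :> R /\ sin (z%:~R * (2 * pi)) = 0 :> R.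
Proof.
have nat_case (n : nat) : cos (n%:R * (2 * pi)) = 1 :> R /\ sin (n%:R * (2 * pi)) = 0 :> R.
  elim: n => [|n [IHc IHs]]; first by rewrite mul0r cos0 sin0.
  have p2 : 2 * pi = pi + pi :> R by ring.
  rewrite -natr1 mulrDl mul1r cosD sinD IHc IHs p2 cosDpi sinDpi cospi sinpi.
  by split; ring.
case: z => n; first exact: nat_case.
have [c s] := nat_case n.+1.
by rewrite NegzE mulrNz mulNr cosN sinN c s oppr0.
Qed.

Lemma Rintegral_circle_cos (z : int) : z != 0 ->
  \int[circle]_x cos (z%:~R * x) = 0.
Proof.
move=> z0; have zR : (z%:~R : R) != 0 by rewrite intr_eq0.
have fi : circle.-integrable setT (EFin \o (fun x => cos (z%:~R * x))).
  by apply: bounded1_integrable => // x; exact: cos_norm_le1.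
have cf : continuous (fun x : R => cos (z%:~R * x)).
  by move=> x; apply: continuous_comp; [exact: cmul|exact: continuous_cos].
have dF (x : R) : is_derive x 1 (fun x => z%:~R^-1 * sin (z%:~R * x)) (cos (z%:~R * x)).
  apply: is_derive_eq; rewrite /GRing.scale/=.
  by field.
rewrite (Rintegral_circle_deriv fi cf dF).
by have [_ ->] := cos_sin_2pi_int z; rewrite !mulr0 sin0 !mulr0 subrr.
Qed.

Lemma Rintegral_circle_sin (z : int) : \int[circle]_x sin (z%:~R * x) = 0.
Proof.
have [->|z0] := eqVneq z 0.
  under eq_Rintegral do rewrite mul0r sin0.
  by rewrite Rintegral_cst//= mul0r.
have zR : (z%:~R : R) != 0 by rewrite intr_eq0.
have fi : circle.-integrable setT (EFin \o (fun x => sin (z%:~R * x))).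
  by apply: bounded1_integrable => // x; exact: sin_norm_le1.
have cf : continuous (fun x : R => sin (z%:~R * x)).
  by move=> x; apply: continuous_comp; [exact: cmul|exact: continuous_sin].
have dF (x : R) : is_derive x 1 (fun x => - z%:~R^-1 * cos (z%:~R * x)) (sin (z%:~R * x)).
  apply: is_derive_eq; rewrite /GRing.scale/=.
  by field.
rewrite (Rintegral_circle_deriv fi cf dF).
by have [-> _] := cos_sin_2pi_int z; rewrite mulr0 cos0 subrr.
Qed.

Lemma circle_measureT : fine (circle setT) = 2 * pi.
Proof.
change (fine (lebesgue_measure (setT `&` `[0%R, (2 * pi)%R : R])) = 2 * pi).
rewrite setTI lebesgue_measure_itv/= lte_fin mulr_gt0 ?pi_gt0//.
by rewrite sube0.
Qed.

End circle_integrals.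

Section torus_integrals.
Variable R : realType.

Lemma dotk_cons d (z : int) (k : d.-tuple int) (y : R) (t : d.-tuple R) :
  dotk [tuple of z :: k] [tuple of y :: t] = z%:~R * y + dotk k t.
Proof.
rewrite /dotk big_ord_recl !tnth0; congr (_ + _).
by apply: eq_bigr => j _; rewrite !tnthS.
Qed.

Definition freq0 d : d.-tuple int := [tuple of nseq d 0].

Lemma dotk0 d (x : d.-tuple R) : dotk (freq0 d) x = 0.
Proof.
by rewrite /dotk big1// => j _; rewrite tnth_nseq mul0r.
Qed.

Let mcosk d (k : d.-tuple int) :
  measurable_fun [set: d.-tuple (measurableTypeR R)] (fun x => cos (dotk k x)).
Proof. by apply: measurable_trig_poly; exact: trig_poly_cos. Qed.

Let msink d (k : d.-tuple int) :
  measurable_fun [set: d.-tuple (measurableTypeR R)] (fun x => sin (dotk k x)).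
Proof. by apply: measurable_trig_poly; exact: trig_poly_sin. Qed.

Let mcosz (z : int) :
  measurable_fun [set: measurableTypeR R] (fun x => cos (z%:~R * x)).
Proof.
apply: measurableT_comp; last exact: measurable_funM.
by apply: continuous_measurable_fun; exact: continuous_cos.
Qed.

Let msinz (z : int) :
  measurable_fun [set: measurableTypeR R] (fun x => sin (z%:~R * x)).
Proof.
apply: measurableT_comp; last exact: measurable_funM.
by apply: continuous_measurable_fun; exact: continuous_sin.
Qed.

Let int_cos d (k : d.-tuple int) := \int[torus_measure R d]_x cos (dotk k x).
Let int_sin d (k : d.-tuple int) := \int[torus_measure R d]_x sin (dotk k x).

Let zsplit d (z : int) (k : d.-tuple int) (y : R) (t : d.-tuple R) :
  dotk [tuple of z :: freq0 d] [tuple of y :: t] = z%:~R * y /\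
  dotk [tuple of (0 : int) :: k] [tuple of y :: t] = dotk k t.
Proof. by rewrite !dotk_cons dotk0 addr0 mul0r add0r. Qed.

(** Split the phase into the parts with frequencies [z :: 0] and [0 :: k], expand by the addition
    formulas and integrate each product by Fubini. Cosine and sine are treated together because each
    recursion involves both. *)
Lemma Rintegral_torus_cons d (z : int) (k : d.-tuple int) :
  int_cos [tuple of z :: k] =
    (\int[circle_measure R]_x cos (z%:~R * x)) * int_cos k -
    (\int[circle_measure R]_x sin (z%:~R * x)) * int_sin k /\
  int_sin [tuple of z :: k] =
    (\int[circle_measure R]_x sin (z%:~R * x)) * int_cos k +
    (\int[circle_measure R]_x cos (z%:~R * x)) * int_sin k.
Proof.
pose a := [tuple of z :: freq0 d]; pose b := [tuple of (0 : int) :: k].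
have ab (x : d.+1.-tuple R) : dotk [tuple of z :: k] x = dotk a x + dotk b x.
  case/tupleP: x => y t; have [-> ->] := zsplit z k y t.
  by rewrite dotk_cons.
have bd (f g : R -> R) : (forall x, `|f x| <= 1) -> (forall x, `|g x| <= 1) ->
    forall x : d.+1.-tuple R, `|f (dotk a x) * g (dotk b x)| <= 1.
  by move=> f1 g1 x; rewrite normrM mulr_ile1.
have ii (f g : R -> R) : (forall x, `|f x| <= 1) -> (forall x, `|g x| <= 1) ->
    measurable_fun [set: d.+1.-tuple (measurableTypeR R)] (fun x => f (dotk a x)) ->
    measurable_fun [set: d.+1.-tuple (measurableTypeR R)] (fun x => g (dotk b x)) ->
    (torus_measure R d.+1).-integrable setT (EFin \o (fun x => f (dotk a x) * g (dotk b x))).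
  move=> f1 g1 mf mg; apply: bounded1_integrable; first exact: measurable_funM.
  exact: bd.
have c1 := @cos_norm_le1 R; have s1 := @sin_norm_le1 R.
split.
  rewrite /int_cos; under eq_Rintegral do rewrite ab cosD.
  rewrite (RintegralB measurableT (ii _ _ c1 c1 (mcosk a) (mcosk b))
    (ii _ _ s1 s1 (msink a) (msink b))); congr (_ - _).
  apply: (Rintegral_tuple_cons (circle_measure R)
    (f := fun y => cos (z%:~R * y)) (g := fun t => cos (dotk k t))) => //.
  - exact: measurable_funM (mcosk a) (mcosk b).
  - by move=> y t; have [-> ->] := zsplit z k y t.
  apply: (Rintegral_tuple_cons (circle_measure R)
    (f := fun y => sin (z%:~R * y)) (g := fun t => sin (dotk k t))) => //.
  - exact: measurable_funM (msink a) (msink b).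
  - by move=> y t; have [-> ->] := zsplit z k y t.
rewrite /int_sin; under eq_Rintegral do rewrite ab sinD.
rewrite (RintegralD measurableT (ii _ _ s1 c1 (msink a) (mcosk b))
  (ii _ _ c1 s1 (mcosk a) (msink b))); congr (_ + _).
apply: (Rintegral_tuple_cons (circle_measure R)
  (f := fun y => sin (z%:~R * y)) (g := fun t => cos (dotk k t))) => //.
- exact: measurable_funM (msink a) (mcosk b).
- by move=> y t; have [-> ->] := zsplit z k y t.
apply: (Rintegral_tuple_cons (circle_measure R)
  (f := fun y => cos (z%:~R * y)) (g := fun t => sin (dotk k t))) => //.
- exact: measurable_funM (mcosk a) (msink b).
- by move=> y t; have [-> ->] := zsplit z k y t.
Qed.

Lemma Rintegral_torus_cos_sin d (k : d.-tuple int) : k != freq0 d ->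
  \int[torus_measure R d]_x cos (dotk k x) = 0 /\
  \int[torus_measure R d]_x sin (dotk k x) = 0.
Proof.
elim: d k => [|d IH] k; first by rewrite tuple0 (tuple0 (freq0 0)) eqxx.
case/tupleP: k => z k k0.
change (int_cos [tuple of z :: k] = 0 /\ int_sin [tuple of z :: k] = 0).
have [-> ->] := Rintegral_torus_cons z k.
rewrite Rintegral_circle_sin !mul0r subr0 add0r.
have [kz|kz] := eqVneq k (freq0 d); last first.
  by have [c s] := IH _ kz; rewrite /int_cos /int_sin c s !mulr0.
have z0 : z != 0.
  by apply: contraNneq k0 => ->; rewrite kz; apply/eqP/val_inj.
by rewrite Rintegral_circle_cos// !mul0r.
Qed.

Lemma torus_measureT d : fine (torus_measure R d setT) = (2 * pi) ^+ d.
Proof.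
elim: d => [|d IH]; first by rewrite -[RHS]/(fine 1%E); congr fine; exact: diracT.
change (fine ((circle_measure R \x torus_measure R d)%E (@cons_pair _ (measurableTypeR R) d @^-1` setT))
  = (2 * pi) ^+ d.+1).
rewrite preimage_setT -setXTT product_measure1E// fineM ?fin_num_measure//.
by rewrite circle_measureT IH exprS.
Qed.

End torus_integrals.

Section square_integrable.
Context d (T : measurableType d) (R : realType).
Variable mu : {finite_measure set T -> \bar R}.

Lemma bounded1_Lfun2 (f : T -> R) : measurable_fun setT f ->
  (forall x, `|f x| <= 1) -> f \in Lfun mu 2%:E.
Proof.
move=> mf f1; rewrite inE/=; apply/andP; split; rewrite inE//=.
rewrite /finite_norm unlock poweR_lty//.
apply: le_lt_trans (_ : (\int[mu]_x (cst 1%E x) < +oo)%E); last first.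
  by rewrite integral_cst// mul1e; have := fin_num_measure mu _ (@measurableT _ T);
    rewrite fin_numElt => /andP[].
apply: ge0_le_integral => //.
- by move=> x _; rewrite lee_fin powR_ge0.
- apply/measurable_EFinP; apply: (@measurableT_comp _ _ _ _ _ _ (@powR R ^~ 2)) => //.
  exact: measurableT_comp.
- by move=> x _; rewrite lee_fin powR_mulrn// exprn_ile1.
Qed.

Lemma Lfun2_mul_integrable (f g : T -> R) :
  f \in Lfun mu 2%:E -> g \in Lfun mu 2%:E ->
  mu.-integrable setT (EFin \o (fun x => f x * g x)).
Proof. by move=> fL gL; exact/Lfun1_integrable/Lfun2_mul_Lfun1. Qed.

End square_integrable.

Lemma normc_sqr (R : rcfType) (z : R[i]) :
  Normc.normc z ^+ 2 = complex.Re z ^+ 2 + complex.Im z ^+ 2.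
Proof. by case: z => a b /=; rewrite sqr_sqrtr// addr_ge0 ?sqr_ge0. Qed.

(** * Exponentials as classes in L2 *)

Section torus_fourier.
Variables (R : realType) (d : nat).
Local Notation T := (d.-tuple (measurableTypeR R)).
Local Notation mu := (torus_measure R d).
Implicit Types (f g : torus_L2 R d) (k l : d.-tuple int).

Definition L2_sqnorm f : R := \int[mu]_x (Normc.normc (repr f x) ^+ 2).

Lemma L2_normE f : L2_norm f = Num.sqrt (L2_sqnorm f).
Proof. by []. Qed.

Lemma repr_Lfun2 f : (fun x => complex.Re (repr f x)) \in Lfun mu 2%:E /\
  (fun x => complex.Im (repr f x)) \in Lfun mu 2%:E.
Proof. by case: (repr f) => u /= /andP[]. Qed.

Lemma Lfun2_measurable (u : T -> R) : u \in Lfun mu 2%:E -> measurable_fun setT u.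
Proof. by rewrite inE => /andP[]; rewrite inE. Qed.

(** The representative chosen by [repr] is arbitrary; this allows the norm to be computed from
    explicit functions. *)
Lemma L2_sqnorm_ae f (u v : T -> R) :
  measurable_fun setT u -> measurable_fun setT v ->
  (\forall x \ae mu, repr f x = u x +i* v x) ->
  L2_sqnorm f = \int[mu]_x (u x ^+ 2 + v x ^+ 2).
Proof.
move=> mu' mv fu; have [fr fi] := repr_Lfun2 f.
rewrite /L2_sqnorm /Rintegral; congr fine; apply: ge0_ae_eq_integral => //.
- apply/measurable_EFinP; under eq_fun do rewrite normc_sqr.
  by apply: measurable_funD; apply: measurable_funX; exact: Lfun2_measurable.
- by apply/measurable_EFinP/measurable_funD; exact: measurable_funX.
- by move=> x _; rewrite lee_fin sqr_ge0.
- by move=> x _; rewrite lee_fin addr_ge0 ?sqr_ge0.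
- apply: filterS fu => x fx _; rewrite fx normc_sqr//.
Qed.

Lemma cosk_Lfun2 k : (fun x : T => cos (dotk k x)) \in Lfun mu 2%:E.
Proof.
apply: bounded1_Lfun2; last by move=> x; exact: cos_norm_le1.
by apply: measurable_trig_poly; exact: trig_poly_cos.
Qed.

Lemma sink_Lfun2 k : (fun x : T => sin (dotk k x)) \in Lfun mu 2%:E.
Proof.
apply: bounded1_Lfun2; last by move=> x; exact: sin_norm_le1.
by apply: measurable_trig_poly; exact: trig_poly_sin.
Qed.

Lemma cisk_L2_pred k : (fun x : T => cis (dotk k x)) \in L2_pred mu.
Proof. by apply/andP; split; [exact: cosk_Lfun2|exact: sink_Lfun2]. Qed.

Definition cisk k : torus_L2 R d := \pi_(L2 mu) (Build_L2_fun (cisk_L2_pred k)).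

Lemma repr_cisk k : \forall x \ae mu, repr (cisk k) x = cis (dotk k x).
Proof.
have /eqP/pi_L2P// : \pi_(L2 mu) (repr (cisk k)) =
  \pi_(L2 mu) (Build_L2_fun (cisk_L2_pred k)) by rewrite reprK.
Qed.

Definition normk : R := (2 * pi) `^ (- (d%:R / 2)).

Lemma normk_sqr : normk ^+ 2 * (2 * pi) ^+ d = 1.
Proof.
have p0 : 0 < 2 * pi :> R by rewrite mulr_gt0 ?pi_gt0.
rewrite /normk powR_sqr -powR_mulrn ?(ltW p0)// -powRD; last by rewrite (lt0r_neq0 p0) implybT.
by rewrite (_ : _ + _ = 0) ?powRr0//; field.
Qed.

Definition fourier_basis k : torus_L2 R d := normk%:C *: cisk k.

Lemma L2_mul_cisN f k :
  cintegrable mu (fun x => repr f x * cis (- dotk k x)) /\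
  forall x, repr f x * cis (- dotk k x) =
    (complex.Re (repr f x) * cos (dotk k x) + complex.Im (repr f x) * sin (dotk k x)) +i*
    (complex.Im (repr f x) * cos (dotk k x) - complex.Re (repr f x) * sin (dotk k x)).
Proof.
have E x : repr f x * cis (- dotk k x) =
    (complex.Re (repr f x) * cos (dotk k x) + complex.Im (repr f x) * sin (dotk k x)) +i*
    (complex.Im (repr f x) * cos (dotk k x) - complex.Re (repr f x) * sin (dotk k x)).
  case: (repr f x) => p q /=; rewrite /cis cosN sinN; congr Complex.
    by ring.
  by ring.
split=> //; have [fr fi] := repr_Lfun2 f.
split.
  under eq_fun do rewrite E/= EFinD.
  by apply: integrableD => //; apply: Lfun2_mul_integrable => //;
    [exact: cosk_Lfun2|exact: sink_Lfun2].
under eq_fun do rewrite E/= EFinB.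
by apply: integrableB => //; apply: Lfun2_mul_integrable => //;
  [exact: cosk_Lfun2|exact: sink_Lfun2].
Qed.

Lemma fourier_coefE f k : fourier_coef f k =
  (normk * \int[mu]_x (complex.Re (repr f x) * cos (dotk k x) +
      complex.Im (repr f x) * sin (dotk k x))) +i*
  (normk * \int[mu]_x (complex.Im (repr f x) * cos (dotk k x) -
      complex.Re (repr f x) * sin (dotk k x))).
Proof.
have [_ E] := L2_mul_cisN f k; rewrite /fourier_coef /cintegral -/normk.
under eq_Rintegral do rewrite E /=.
under [X in _ +i* X]eq_Rintegral do rewrite E /=.
by rewrite /GRing.mul/= !mul0r subr0 addr0.
Qed.

End torus_fourier.

(** * Orthonormality and Bessel's identity *)

Section bessel.
Variables (R : realType) (d : nat).
Local Notation T := (d.-tuple (measurableTypeR R)).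
Local Notation mu := (torus_measure R d).
Implicit Types (f g : torus_L2 R d) (k l : d.-tuple int).

Lemma fourier_coef0 k : fourier_coef (0 : torus_L2 R d) k = 0.
Proof.
have := fourier_coef_lin 1 (0 : torus_L2 R d) 0 k.
by rewrite scaler0 addr0 mul1r => /esym/eqP; rewrite -subr_eq0 addrK => /eqP.
Qed.

Lemma fourier_coefZ a f k : fourier_coef (a *: f) k = a * fourier_coef f k.
Proof. by rewrite -[a *: f]addr0 fourier_coef_lin fourier_coef0 addr0. Qed.

Lemma fourier_coefD f g k : fourier_coef (f + g) k = fourier_coef f k + fourier_coef g k.
Proof. by rewrite -[f in LHS]scale1r fourier_coef_lin mul1r. Qed.

Lemma fourier_coefB f g k : fourier_coef (f - g) k = fourier_coef f k - fourier_coef g k.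
Proof. by rewrite fourier_coefD -scaleN1r fourier_coefZ mulN1r. Qed.

Lemma fourier_coef_sum (I : Type) (s : seq I) (F : I -> torus_L2 R d) k :
  fourier_coef (\sum_(i <- s) F i) k = \sum_(i <- s) fourier_coef (F i) k.
Proof.
elim: s => [|i s IH]; first by rewrite !big_nil fourier_coef0.
by rewrite !big_cons fourier_coefD IH.
Qed.

Definition freqD k l : d.-tuple int := [tuple tnth k j + tnth l j | j < d].
Definition freqN k : d.-tuple int := [tuple - tnth k j | j < d].

Lemma dotk_freqD k l (x : d.-tuple R) : dotk (freqD k l) x = dotk k x + dotk l x.
Proof.
rewrite /dotk -big_split/=; apply: eq_bigr => j _.
by rewrite tnth_mktuple intrD mulrDl.
Qed.

Lemma dotk_freqN k (x : d.-tuple R) : dotk (freqN k) x = - dotk k x.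
Proof.
rewrite /dotk -sumrN; apply: eq_bigr => j _.
by rewrite tnth_mktuple mulrNz mulNr.
Qed.

Lemma freqDN_eq0 k l : (freqD k (freqN l) == freq0 d) = (k == l).
Proof.
apply/eqP/eqP => [h|->]; last first.
  by apply: eq_from_tnth => j; rewrite !tnth_mktuple tnth_nseq subrr.
apply: eq_from_tnth => j; apply/eqP; rewrite -subr_eq0; apply/eqP.
by have := congr1 (fun t => tnth t j) h; rewrite !tnth_mktuple tnth_nseq.
Qed.

Lemma cisD (x y : R) : cis x * cis y = cis (x + y).
Proof.
by rewrite /cis cosD sinD; simpc; congr (_ +i* _); rewrite addrC.
Qed.

Lemma fourier_coef_cisk l k :
  fourier_coef (cisk R l) k = (normk R d * ((2 * pi) ^+ d *+ (l == k)))%:C.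
Proof.
have -> : fourier_coef (cisk R l) k = (normk R d)%:C * cintegral mu
    (fun x => cis (dotk (freqD l (freqN k)) x)).
  rewrite /fourier_coef -/(normk R d); congr (_ * _); apply: cintegral_ae.
  - by have [] := L2_mul_cisN (cisk R l) k.
  - by split; apply/Lfun1_integrable/Lfun_subset12;
      [exact: fin_num_measure|exact: cosk_Lfun2|exact: fin_num_measure|exact: sink_Lfun2].
  apply: filterS (repr_cisk R l) => x ->.
  by rewrite cisD dotk_freqD dotk_freqN.
rewrite /cintegral /=; have [lk|lk] := eqVneq l k; last first.
  rewrite -freqDN_eq0 in lk; have [-> ->] := Rintegral_torus_cos_sin R lk.
  by rewrite mulr0n !mulr0.
have e0 x : dotk (freqD l (freqN k)) x = 0 :> R.
  by rewrite lk dotk_freqD dotk_freqN subrr.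
under eq_Rintegral do rewrite e0 cos0.
under [X in _ +i* X]eq_Rintegral do rewrite e0 sin0.
rewrite !Rintegral_cst// torus_measureT mul1r mul0r mulr1n.
by rewrite /GRing.mul/= !mul0r mulr0 subr0 addr0.
Qed.

Lemma fourier_coef_basis l k : fourier_coef (fourier_basis R l) k = (l == k)%:R.
Proof.
rewrite /fourier_basis fourier_coefZ fourier_coef_cisk -rmorphM/= mulrA -expr2.
by case: eqP => _; rewrite ?mulr1n ?mulr0n ?mulr0// normk_sqr.
Qed.

(** Pythagoras for one vector, by expanding the square pointwise with [C^2 + S^2 = 1]: the cross
    terms are the integrands [v1] and [v2] of the Fourier coefficient, and the constant term
    integrates to [|a|^2] by the choice of [normk]. *)
Lemma L2_sqnorm_sub_coef f k :
  L2_sqnorm (f - fourier_coef f k *: fourier_basis R k) =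
  L2_sqnorm f - Normc.normc (fourier_coef f k) ^+ 2.
Proof.
set a := fourier_coef f k; set nk := normk R d.
pose a1 := complex.Re a; pose a2 := complex.Im a.
pose p x := complex.Re (repr f x); pose q x := complex.Im (repr f x).
pose C (x : T) := cos (dotk k x) : R; pose S (x : T) := sin (dotk k x) : R.
have [fr fi] := repr_Lfun2 f.
have mp := Lfun2_measurable fr; have mq := Lfun2_measurable fi.
have mC := Lfun2_measurable (cosk_Lfun2 R k); have mS := Lfun2_measurable (sink_Lfun2 R k).
have -> : f - a *: fourier_basis R k = (- (a * nk%:C)) *: cisk R k + f.
  by rewrite /fourier_basis scalerA scaleNr addrC.
rewrite (@L2_sqnorm_ae _ _ _ (fun x => p x - nk * (a1 * C x - a2 * S x))
  (fun x => q x - nk * (a1 * S x + a2 * C x))); last 3 first.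
- apply: measurable_funB => //; apply: measurable_funM => //.
  by apply: measurable_funB; apply: measurable_funM.
- apply: measurable_funB => //; apply: measurable_funM => //.
  by apply: measurable_funD; apply: measurable_funM.
- apply: filterS2 (repr_L2_lin (- (a * nk%:C)) (cisk R k) f) (repr_cisk R k) => x -> ->.
  rewrite /p /q /C /S /a1 /a2; case: (a) => b1 b2; case: (repr f x) => u v.
  by rewrite /cis /=; congr Complex; ring.
pose v1 x := p x * C x + q x * S x; pose v2 x := q x * C x - p x * S x.
have [[iv1 iv2] vE] := L2_mul_cisN f k.
have {}iv1 : mu.-integrable setT (EFin \o v1).
  by apply: eq_integrable iv1 => // x _; rewrite vE.
have {}iv2 : mu.-integrable setT (EFin \o v2).
  by apply: eq_integrable iv2 => // x _; rewrite vE.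
have aE : a = (nk * \int[mu]_x v1 x) +i* (nk * \int[mu]_x v2 x).
  exact: fourier_coefE.
have isq : mu.-integrable setT (EFin \o (fun x => p x ^+ 2 + q x ^+ 2)).
  exact: (integrableD measurableT (Lfun2_integrable_sqr fr) (Lfun2_integrable_sqr fi)).
have icst : mu.-integrable setT (EFin \o cst (nk ^+ 2 * (a1 ^+ 2 + a2 ^+ 2))).
  exact: integrable_cst_fin.
have ih : mu.-integrable setT
    (EFin \o (fun x => (p x ^+ 2 + q x ^+ 2) + cst (nk ^+ 2 * (a1 ^+ 2 + a2 ^+ 2)) x)).
  exact: (integrableD measurableT isq icst).
have [_ E] := integrable_lin (- 2 * nk * a1) (- 2 * nk * a2) iv1 iv2 ih.
transitivity (\int[mu]_x (- 2 * nk * a1 * v1 x + - 2 * nk * a2 * v2 x +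
    ((p x ^+ 2 + q x ^+ 2) + cst (nk ^+ 2 * (a1 ^+ 2 + a2 ^+ 2)) x))).
  apply: eq_Rintegral => x _; rewrite /v1 /v2 /=.
  have : C x ^+ 2 = 1 - S x ^+ 2 by rewrite -(cos2Dsin2 (dotk k x)) addrK.
  move: (C x) (S x) (p x) (q x) => c s u v cs.
  have -> : (u - nk * (a1 * c - a2 * s)) ^+ 2 + (v - nk * (a1 * s + a2 * c)) ^+ 2 =
    u ^+ 2 + v ^+ 2 + - 2 * nk * a1 * (u * c + v * s) + - 2 * nk * a2 * (v * c - u * s)
    + nk ^+ 2 * (a1 ^+ 2 + a2 ^+ 2) * (c ^+ 2 + s ^+ 2) by ring.
  by rewrite cs; ring.
rewrite E (RintegralD measurableT isq icst) Rintegral_cst// torus_measureT.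
have -> : \int[mu]_x (p x ^+ 2 + q x ^+ 2) = L2_sqnorm f.
  by apply: eq_Rintegral => x _; rewrite normc_sqr.
rewrite normc_sqr -/a1 -/a2.
have -> : nk ^+ 2 * (a1 ^+ 2 + a2 ^+ 2) * (2 * pi) ^+ d = a1 ^+ 2 + a2 ^+ 2.
  by rewrite mulrAC normk_sqr mul1r.
have e1 : nk * \int[mu]_x v1 x = a1 by rewrite /a1 aE.
have e2 : nk * \int[mu]_x v2 x = a2 by rewrite /a2 aE.
by move: e1 e2; move: (\int[mu]_x v1 x) (\int[mu]_x v2 x) => w1 w2 <- <-; ring.
Qed.

Definition fourier_proj (s : seq (d.-tuple int)) f : torus_L2 R d :=
  \sum_(k <- s) fourier_coef f k *: fourier_basis R k.

Lemma fourier_coef_comb (s : seq (d.-tuple int)) (a : d.-tuple int -> R[i]) k :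
  uniq s -> fourier_coef (\sum_(l <- s) a l *: fourier_basis R l) k =
    if k \in s then a k else 0.
Proof.
move=> us; rewrite fourier_coef_sum.
under eq_bigr do rewrite fourier_coefZ fourier_coef_basis.
case: ifPn => ks.
  rewrite (bigD1_seq k)//= eqxx mulr1 big1 ?addr0// => l /negbTE ->.
  by rewrite mulr0.
rewrite big1_seq// => l /andP[_ ls]; case: eqVneq => [lk|_]; last by rewrite mulr0.
by rewrite -lk ls in ks.
Qed.

(** One basis vector is subtracted at a time; as [k] is not in [s], the earlier subtractions leave
    the coefficient at [k] unchanged. *)
Lemma bessel (s : seq (d.-tuple int)) f : uniq s ->
  L2_sqnorm (f - fourier_proj s f) =
  L2_sqnorm f - \sum_(k <- s) Normc.normc (fourier_coef f k) ^+ 2.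
Proof.
elim: s => [_|k s IH /=/andP[ks us]]; first by rewrite /fourier_proj !big_nil !subr0.
rewrite /fourier_proj !big_cons opprD addrA addrAC -/(fourier_proj s f).
have ck : fourier_coef (f - fourier_proj s f) k = fourier_coef f k.
  by rewrite fourier_coefB fourier_coef_comb// (negbTE ks) subr0.
by rewrite -{1}ck L2_sqnorm_sub_coef IH// ck opprD addrAC addrA.
Qed.

End bessel.

(** * Parseval's identity in approximate form *)

Section parseval.
Variables (R : realType) (d : nat).
Local Notation T := (d.-tuple (measurableTypeR R)).
Local Notation mu := (torus_measure R d).
Implicit Types (f g : torus_L2 R d) (k l : d.-tuple int).

(** Euler's formulas for cosine and sine; in a product the frequencies add. *)
Lemma trig_poly_span (p : T -> R) : trig_poly p ->
  exists t : seq (R[i] * d.-tuple int), forall x,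
    (p x)%:C = \sum_(ak <- t) ak.1 * cis (dotk ak.2 x).
Proof.
elim=> [c|k|k|{}p q _ [tp Ep] _ [tq Eq]|{}p q _ [tp Ep] _ [tq Eq]].
- exists [:: (c%:C, freq0 d)] => x.
  by rewrite big_seq1/= dotk0 /cis cos0 sin0 mulr1.
- exists [:: ((1 / 2)%:C, k); ((1 / 2)%:C, freqN k)] => x.
  rewrite !big_cons big_nil/= dotk_freqN /cis cosN sinN; simpc.
  by congr Complex; field.
- exists [:: (0 -i* (1 / 2), k); (0 +i* (1 / 2), freqN k)] => x.
  rewrite !big_cons big_nil/= dotk_freqN /cis cosN sinN; simpc.
  by congr Complex; field.
- by exists (tp ++ tq) => x; rewrite rmorphD/= Ep Eq big_cat.
exists [seq (a.1 * b.1, freqD a.2 b.2) | a <- tp, b <- tq] => x.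
rewrite rmorphM/= Ep Eq big_allpairs_dep/= mulr_suml; apply: eq_bigr => a _.
rewrite mulr_sumr; apply: eq_bigr => b _.
by rewrite dotk_freqD -cisD mulrACA.
Qed.

Definition cisk_comb (t : seq (R[i] * d.-tuple int)) : torus_L2 R d :=
  \sum_(ak <- t) ak.1 *: cisk R ak.2.

Lemma repr_cisk_comb t : \forall x \ae mu,
  repr (cisk_comb t) x = \sum_(ak <- t) ak.1 * cis (dotk ak.2 x).
Proof.
have FF : Filter (nbhs (almost_everywhere mu)) by exact: ae_filter_ringOfSetsType.
elim: t => [|[a k] t IH].
  have := repr_L2_lin (-1) (0 : torus_L2 R d) 0; rewrite /cisk_comb big_nil.
  rewrite scaler0 addr0; apply: filterS => x; rewrite mulN1r addNr => ->.
  by rewrite big_nil.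
rewrite /cisk_comb big_cons -/(cisk_comb t) /=.
apply: filterS3 (repr_L2_lin a (cisk R k) (cisk_comb t)) (repr_cisk R k) IH.
by move=> x -> -> ->; rewrite big_cons.
Qed.

Lemma fourier_proj_cisk_comb (s : seq (d.-tuple int)) t : uniq s ->
  {subset [seq ak.2 | ak <- t] <= s} -> fourier_proj s (cisk_comb t) = cisk_comb t.
Proof.
move=> us ts; rewrite /fourier_proj /cisk_comb.
under eq_bigr do rewrite fourier_coef_sum scaler_suml.
rewrite exchange_big/=; apply: eq_big_seq => -[a l] lt /=.
have ls : l \in s by apply: ts; apply/mapP; exists (a, l).
rewrite (bigD1_seq l)//= big1 ?addr0.
  rewrite fourier_coefZ fourier_coef_cisk eqxx mulr1n /fourier_basis scalerA.
  rewrite -mulrA -rmorphM/= mulrAC -expr2 normk_sqr.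
  by rewrite mulr1.
move=> k /negbTE kl; rewrite fourier_coefZ fourier_coef_cisk eq_sym kl.
by rewrite mulr0n !mulr0 scale0r.
Qed.

Lemma fourier_projB s f g : fourier_proj s (f - g) = fourier_proj s f - fourier_proj s g.
Proof.
rewrite /fourier_proj -sumrB; apply: eq_bigr => k _.
by rewrite fourier_coefB scalerBl.
Qed.

(** Let [g] be [f] minus an approximating trigonometric polynomial with frequencies in [s]. The
    projection onto [s] fixes that polynomial, so [f] and [g] have the same remainder, of norm at
    most that of [g]. A prescribed [S] is included in [s] so that the sum can be split along [S]
    when a tail is estimated. *)
Lemma parseval_approx (S : seq (d.-tuple int)) f (e : R) : 0 < e ->
  exists s, [/\ uniq s, {subset S <= s} &
    L2_sqnorm f - \sum_(k <- s) Normc.normc (fourier_coef f k) ^+ 2 < e].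
Proof.
move=> e0; have [fr fi] := repr_Lfun2 f.
have mr := Lfun2_measurable fr; have mi := Lfun2_measurable fi.
have e2 : 0 < e / 2 by rewrite divr_gt0.
have [_ /(_ _ e2)[p tp fp]] := trig_poly_dense mr (Lfun2_integrable_sqr fr).
have [_ /(_ _ e2)[q tq fq]] := trig_poly_dense mi (Lfun2_integrable_sqr fi).
have [t Et] := trig_poly_span tp; have [t' Et'] := trig_poly_span tq.
(* The combination [p + i q] of the approximants to the real and imaginary parts of [f]. *)
pose tt := t ++ [seq ('i * ak.1, ak.2) | ak <- t'].
pose g := f - cisk_comb tt.
have mp := measurable_trig_poly tp; have mq := measurable_trig_poly tq.
have FF : Filter (nbhs (almost_everywhere mu)) by exact: ae_filter_ringOfSetsType.
have gE : L2_sqnorm g = \int[mu]_x ((complex.Re (repr f x) - p x) ^+ 2 +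
    (complex.Im (repr f x) - q x) ^+ 2).
  apply: L2_sqnorm_ae; [exact: measurable_funB|exact: measurable_funB|].
  rewrite /g addrC -scaleN1r.
  apply: filterS2 (repr_L2_lin (-1) (cisk_comb tt) f) (repr_cisk_comb tt) => x -> ->.
  rewrite big_cat/= -Et big_map/=.
  rewrite (eq_bigr (fun ak => 'i * (ak.1 * cis (dotk ak.2 x)))); last first.
    by move=> ak _; rewrite mulrA.
  rewrite -mulr_sumr -Et'; case: (repr f x) => u v /=.
  by simpc; congr Complex; rewrite addrC.
have ge : L2_sqnorm g < e.
  have h : (\int[mu]_x ((complex.Re (repr f x) - p x) ^+ 2 +
    (complex.Im (repr f x) - q x) ^+ 2)%:E < e%:E)%E.
    under eq_integral do rewrite EFinD.
    rewrite ge0_integralD//.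
    - by rewrite (splitr e) EFinD; exact: lteD.
    - by move=> x _; rewrite lee_fin sqr_ge0.
    - by apply/measurable_EFinP/measurable_funX/measurable_funB.
    - by move=> x _; rewrite lee_fin sqr_ge0.
    - by apply/measurable_EFinP/measurable_funX/measurable_funB.
  rewrite gE /Rintegral -lte_fin fineK// ge0_fin_numE; first exact: lt_trans h (ltry _).
  by apply: integral_ge0 => x _; rewrite lee_fin addr_ge0 ?sqr_ge0.
pose s := undup ([seq ak.2 | ak <- tt] ++ S).
have us : uniq s by exact: undup_uniq.
exists s; split => //; first by move=> k; rewrite mem_undup mem_cat orbC => ->.
rewrite -bessel//.
have -> : f - fourier_proj s f = g - fourier_proj s g.
  rewrite /g fourier_projB fourier_proj_cisk_comb//; last by move=> k; rewrite mem_undup mem_cat => ->.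
  by rewrite opprB addrA addrNK.
rewrite bessel//; apply: le_lt_trans ge; rewrite gerBl.
by apply: sumr_ge0 => k _; exact: sqr_ge0.
Qed.

End parseval.

(** * Approximation numbers *)

Section mix_weights.
Variables (R : realType) (d : nat) (s : R).
Implicit Types (f : torus_L2 R d) (k : d.-tuple int).

Lemma mix_weight_ge1 k : 1 <= mix_weight s k.
Proof.
apply: (@le_trans _ _ (\prod_(j < d) 1)); first by rewrite big1.
by apply: ler_prod => j _; rewrite ler01 lerDl powR_ge0.
Qed.

Lemma sum_le_mix_sqnorm f (S : seq (d.-tuple int)) : uniq S ->
  ((\sum_(k <- S) Normc.normc (fourier_coef f k) ^+ 2 * mix_weight s k)%:E
    <= mix_sqnorm s f)%E.
Proof.
move=> uS; apply: esum_ge; exists [set` S].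
  by split => //; exact: finite_seq.
by rewrite -fsbig_seq// sumEFin.
Qed.

Lemma mix_sqnorm_supp f (S : seq (d.-tuple int)) : uniq S ->
  (forall k, k \notin S -> fourier_coef f k = 0) ->
  mix_sqnorm s f =
    (\sum_(k <- S) Normc.normc (fourier_coef f k) ^+ 2 * mix_weight s k)%:E.
Proof.
move=> uS f0; have w0 k : 0 <= Normc.normc (fourier_coef f k) ^+ 2 * mix_weight s k.
  by rewrite mulr_ge0 ?sqr_ge0// (le_trans ler01)// mix_weight_ge1.
rewrite /mix_sqnorm; transitivity (\esum_(k in [set` S])
    (Normc.normc (fourier_coef f k) ^+ 2 * mix_weight s k)%:E)%E; last first.
  rewrite esum_fset; [|exact: finite_seq|by move=> k _; rewrite lee_fin].
  by rewrite -fsbig_seq// sumEFin.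
rewrite [RHS]esum_mkcond; apply: eq_esum => k _.
case: ifPn => // kS; rewrite f0 ?Normc.normc0 ?expr0n ?mul0r//.
by apply: contra kS => ?; rewrite inE.
Qed.

Lemma mix_sqnorm_fin (f : Hmix d s) :
  mix_sqnorm s (Hmix_val f) = (fine (mix_sqnorm s (Hmix_val f)))%:E.
Proof.
case: f => f /= /asboolP fs; rewrite fineK// ge0_fin_numE//.
apply: esum_ge0 => k _; rewrite lee_fin mulr_ge0 ?sqr_ge0// (le_trans ler01)//.
exact: mix_weight_ge1.
Qed.

Lemma sum_le_Hmix_norm (f : Hmix d s) (S : seq (d.-tuple int)) : uniq S ->
  \sum_(k <- S) Normc.normc (fourier_coef (Hmix_val f) k) ^+ 2 * mix_weight s k
    <= Hmix_norm f ^+ 2.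
Proof.
move=> uS; have := sum_le_mix_sqnorm (Hmix_val f) uS.
rewrite mix_sqnorm_fin lee_fin => h; rewrite /Hmix_norm sqr_sqrtr//.
apply: le_trans h; apply: sumr_ge0 => k _.
by rewrite mulr_ge0 ?sqr_ge0// (le_trans ler01)// mix_weight_ge1.
Qed.

End mix_weights.

(** * Finite combinations of basis vectors *)

Section basis_combinations.
Variables (R : realType) (d : nat).
Implicit Types (f : torus_L2 R d) (S : seq (d.-tuple int)).

Lemma L2_sqnorm0 : L2_sqnorm (0 : torus_L2 R d) = 0.
Proof.
have := repr_cisk_comb (R := R) (d := d) [::]; rewrite /cisk_comb big_nil => h.
rewrite (@L2_sqnorm_ae _ _ _ (cst 0) (cst 0))//.
  under eq_Rintegral do rewrite expr0n addr0.
  by rewrite Rintegral_cst// mul0r.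
by apply: filterS h => x ->; rewrite big_nil.
Qed.

(** Coefficients are indexed by ordinals, as in [has_rank] and in matrices. *)
Definition basis_comb S (c : 'I_(size S) -> R[i]) : torus_L2 R d :=
  \sum_i c i *: fourier_basis R (tnth (in_tuple S) i).

Lemma fourier_coef_basis_comb S (c : 'I_(size S) -> R[i]) i : uniq S ->
  fourier_coef (basis_comb c) (tnth (in_tuple S) i) = c i.
Proof.
move=> uS; rewrite /basis_comb fourier_coef_sum (bigD1 i)//= big1 ?addr0.
  by rewrite fourier_coefZ fourier_coef_basis eqxx mulr1.
move=> j ji; rewrite fourier_coefZ fourier_coef_basis.
rewrite (_ : _ == _ = false) ?mulr0//; apply: contraNF ji => /eqP.
by rewrite !(tnth_nth (freq0 d)) /= => /eqP; rewrite nth_uniq.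
Qed.

Lemma fourier_coef_basis_comb0 S (c : 'I_(size S) -> R[i]) k : k \notin S ->
  fourier_coef (basis_comb c) k = 0.
Proof.
move=> kS; rewrite /basis_comb fourier_coef_sum big1// => j _.
rewrite fourier_coefZ fourier_coef_basis; case: eqVneq => [jk|_]; last by rewrite mulr0.
by move: kS; rewrite -jk mem_tnth.
Qed.

Lemma fourier_projE S f :
  fourier_proj S f = basis_comb (fun i => fourier_coef f (tnth (in_tuple S) i)).
Proof. by rewrite /fourier_proj big_tnth. Qed.

Lemma fourier_proj_basis_comb S (c : 'I_(size S) -> R[i]) : uniq S ->
  fourier_proj S (basis_comb c) = basis_comb c.
Proof.
move=> uS; rewrite fourier_projE /basis_comb; apply: eq_bigr => i _.
by rewrite fourier_coef_basis_comb.
Qed.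

Lemma L2_sqnorm_basis_comb S (c : 'I_(size S) -> R[i]) : uniq S ->
  L2_sqnorm (basis_comb c) = \sum_i Normc.normc (c i) ^+ 2.
Proof.
move=> uS; have := bessel (basis_comb c) uS.
rewrite fourier_proj_basis_comb// subrr L2_sqnorm0 => /esym/eqP.
rewrite subr_eq0 => /eqP ->; rewrite big_tnth; apply: eq_bigr => i _.
by rewrite fourier_coef_basis_comb.
Qed.

Lemma mix_sqnorm_basis_comb (s : R) S (c : 'I_(size S) -> R[i]) : uniq S ->
  mix_sqnorm s (basis_comb c) =
    (\sum_i Normc.normc (c i) ^+ 2 * mix_weight s (tnth (in_tuple S) i))%:E.
Proof.
move=> uS; rewrite (mix_sqnorm_supp s uS); last by move=> k; exact: fourier_coef_basis_comb0.
congr EFin; rewrite big_tnth; apply: eq_bigr => i _.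
by rewrite fourier_coef_basis_comb.
Qed.

Lemma basis_comb_Hmix (s : R) S (c : 'I_(size S) -> R[i]) : uniq S ->
  basis_comb c \in Hmix_pred s.
Proof. by move=> uS; apply/asboolP; rewrite mix_sqnorm_basis_comb// ltry. Qed.

Lemma L2_sqnorm_proj S f : uniq S ->
  L2_sqnorm (fourier_proj S f) = \sum_(k <- S) Normc.normc (fourier_coef f k) ^+ 2.
Proof. by move=> uS; rewrite fourier_projE L2_sqnorm_basis_comb// [RHS]big_tnth. Qed.

(** Outside [S] each [|c_k|^2] is at most [B^2 |c_k|^2] times the weight. Parseval, up to [e], makes
    the squared remainder a finite sum of such terms. *)
Lemma L2_sqnorm_sub_proj (s B : R) S (f : Hmix d s) : uniq S ->
  (forall k, k \notin S -> 1 <= B ^+ 2 * mix_weight s k) ->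
  L2_sqnorm (Hmix_val f - fourier_proj S (Hmix_val f)) <= B ^+ 2 * Hmix_norm f ^+ 2.
Proof.
move=> uS hB; apply/ler_addgt0Pr => e e0; set u := Hmix_val f.
have [t [ut St te]] := parseval_approx S u e0.
rewrite bessel//; move: te.
pose F k := Normc.normc (fourier_coef u k) ^+ 2.
have F0 k : 0 <= F k by exact: sqr_ge0.
have Fw : \sum_(k <- t) F k * mix_weight s k <= Hmix_norm f ^+ 2.
  exact: sum_le_Hmix_norm.
rewrite -/(\sum_(k <- t) F k) -/(\sum_(k <- S) F k); move: F F0 Fw => F F0 Fw.
suff : \sum_(k <- t) F k <= \sum_(k <- S) F k + B ^+ 2 * Hmix_norm f ^+ 2 by lra.
rewrite (bigID (mem S))/=; apply: lerD.
  rewrite -big_filter (perm_big S)//; apply: uniq_perm => //; first exact: filter_uniq.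
  by move=> k; rewrite mem_filter; case: (boolP (k \in S)) => // /St ->.
apply: le_trans (ler_wpM2l (sqr_ge0 B) Fw).
rewrite mulr_sumr big_mkcond/=; apply: ler_sum => k _.
have w1 := mix_weight_ge1 s k; have w0 := le_trans ler01 w1.
case: ifPn => [kS|_]; first by rewrite mulrCA ler_peMr// hB.
by apply: mulr_ge0; rewrite ?sqr_ge0// mulr_ge0.
Qed.

End basis_combinations.

(** * Bounds from a finite set of frequencies *)

Section approximation_bounds.
Variables (R : realType) (d : nat) (s : R).

Definition mix_proj (S : seq (d.-tuple int)) (f : Hmix d s) : torus_L2 R d :=
  fourier_proj S (Hmix_val f).

Lemma mix_proj_linear S : linear (mix_proj S).
Proof.
move=> a f g; rewrite /mix_proj.
have -> : Hmix_val (a *: f + g) = a *: Hmix_val f + Hmix_val g.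
  exact: (linearP (@Hmix_embedding R d s)).
rewrite /fourier_proj scaler_sumr -big_split; apply: eq_bigr => k _.
by rewrite fourier_coef_lin scalerDl -scalerA.
Qed.

HB.instance Definition _ S := GRing.isLinear.Build R[i] (Hmix d s) (torus_L2 R d) *:%R
  (mix_proj S) (mix_proj_linear S).

(** The rank is exact: the coefficients of a combination are its Fourier coefficients, and every
    combination lies in [Hmix] and is fixed by the projection. *)
Lemma has_rank_mix_proj S : uniq S -> has_rank (mix_proj S) (size S).
Proof.
move=> uS; exists (fun i => fourier_basis R (tnth (in_tuple S) i)); split.
  move=> c c0 i; rewrite -(fourier_coef_basis_comb c i uS) /basis_comb c0.
  exact: fourier_coef0.
apply/seteqP; split => [_ [f _ <-]|_ [c _ <-]].
  exists (fun i => fourier_coef (Hmix_val f) (tnth (in_tuple S) i)) => //.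
  by rewrite /mix_proj fourier_projE.
exists (Build_Hmix (basis_comb_Hmix s c uS)) => //.
by rewrite /mix_proj/= fourier_proj_basis_comb.
Qed.

Lemma bounded_mix_proj S : uniq S ->
  bounded_op (@Hmix_norm R d s) (@L2_norm _ _ _ (torus_measure R d)) (mix_proj S).
Proof.
move=> uS; exists 1 => f; rewrite mul1r L2_normE.
rewrite -[leRHS]ger0_norm ?sqrtr_ge0// -sqrtr_sqr; apply: ler_wsqrtr.
rewrite /mix_proj L2_sqnorm_proj//; apply: le_trans (sum_le_Hmix_norm f uS).
by apply: ler_sum => k _; rewrite ler_peMr ?sqr_ge0// mix_weight_ge1.
Qed.

Lemma mix_approx_number_le n (S : seq (d.-tuple int)) (B : R) :
  uniq S -> (size S < n)%N -> 0 <= B ->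
  (forall k, k \notin S -> 1 <= B ^+ 2 * mix_weight s k) ->
  (mix_approx_number d s n <= B%:E)%E.
Proof.
move=> uS Sn B0 hB.
apply: (@le_trans _ _ (opnorm (@Hmix_norm R d s) (@L2_norm _ _ _ (torus_measure R d))
    (fun x => Hmix_embedding x - mix_proj S x))).
  apply: ereal_inf_lbound; exists (mix_proj S) => //; split.
    exact: bounded_mix_proj.
  by exists (size S) => //; exact: has_rank_mix_proj.
apply: ub_ereal_sup => _ [f /= f1 <-]; rewrite lee_fin L2_normE.
rewrite -[leRHS]ger0_norm// -sqrtr_sqr; apply: ler_wsqrtr.
apply: le_trans (L2_sqnorm_sub_proj f uS hB) _.
by rewrite ler_piMr ?sqr_ge0// exprn_ile1// sqrtr_ge0.
Qed.

Lemma mix_approx_number_ge n (S : seq (d.-tuple int)) (B : R) :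
  uniq S -> (n <= size S)%N -> 0 <= B ->
  (forall k, k \in S -> B ^+ 2 * mix_weight s k <= 1) ->
  (B%:E <= mix_approx_number d s n)%E.
Proof.
move=> uS nS B0 hB; apply: le_ereal_inf_tmp => _ [A [_ [r rn [e [_ rA]]]] <-].
pose h i : Hmix d s := Build_Hmix (basis_comb_Hmix s (fun j => (j == i)%:R) uS).
have /choice[M hM] (i : 'I_(size S)) : exists c : 'I_r -> R[i],
    \sum_j c j *: e j = A (h i).
  have : range A (A (h i)) by exists (h i).
  by rewrite rA => -[c _ <-]; exists c.
(* Row [i] holds the coordinates of [A (h i)]. There are [r < n <= size S] columns, so some nonzero
   row vector [v] satisfies [v *m m = 0]. *)
pose m : 'M[R[i]]_(size S, r) := \matrix_(i, j) M i j.
have : kermx m != 0.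
  rewrite kermx_eq0 -row_leq_rank -ltnNge.
  by apply: leq_ltn_trans (rank_leq_col m) _; exact: leq_trans rn nS.
case/rowV0Pn => v /sub_kermxP vm v0.
pose W : R := \sum_i Normc.normc (v 0 i) ^+ 2 * mix_weight s (tnth (in_tuple S) i).
have W0 : 0 < W.
  have Wge i : 0 <= Normc.normc (v 0 i) ^+ 2 * mix_weight s (tnth (in_tuple S) i).
    by rewrite mulr_ge0 ?sqr_ge0// (le_trans ler01)// mix_weight_ge1.
  rewrite lt0r sumr_ge0// andbT psumr_neq0//; move: v0; apply: contraNT.
  move=> /hasPn h0; apply/eqP/rowP => i; rewrite mxE; apply/eqP.
  have := h0 i (mem_index_enum _); rewrite /= lt0r Wge andbT negbK mulf_eq0 => /orP[|].
    by rewrite sqrf_eq0 => /eqP/Normc.eq0_normc ->.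
  by rewrite gt_eqF// (lt_le_trans ltr01)// mix_weight_ge1.
(* [W] is the squared [Hmix] norm of the combination with coefficients [v]; scaling by [t] makes it
   1. *)
pose t : R := (Num.sqrt W)^-1.
have t0 : 0 <= t by rewrite invr_ge0 sqrtr_ge0.
have tW : t ^+ 2 * W = 1 by rewrite exprVn sqr_sqrtr ?(ltW W0)// mulVf ?gt_eqF.
pose c i : R[i] := t%:C * v 0 i.
have nc i : Normc.normc (c i) ^+ 2 = t ^+ 2 * Normc.normc (v 0 i) ^+ 2.
  rewrite /c Normc.normcM exprMn; congr (_ * _).
  by rewrite normc_sqr/= expr0n addr0.
have cW : \sum_i Normc.normc (c i) ^+ 2 * mix_weight s (tnth (in_tuple S) i) = 1.
  rewrite -[RHS]tW /W mulr_sumr; apply: eq_bigr => i _; by rewrite nc [RHS]mulrA.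
pose f : Hmix d s := \sum_i c i *: h i.
have fE : Hmix_val f = basis_comb c.
  transitivity (\sum_i c i *: Hmix_embedding (h i)).
    rewrite -[LHS]/(Hmix_embedding f) /f linear_sum; apply: eq_bigr => i _.
    by rewrite linearZ.
  apply: eq_bigr => i _; congr (_ *: _).
  rewrite /Hmix_embedding /= /basis_comb (bigD1 i)//= eqxx scale1r big1 ?addr0//.
  by move=> j /negbTE ->; rewrite scale0r.
have Af : A f = 0.
  rewrite linear_sum/=.
  transitivity (\sum_i \sum_j (c i * M i j) *: e j).
    apply: eq_bigr => i _; rewrite linearZ/= -hM scaler_sumr.
    by apply: eq_bigr => j _; rewrite scalerA.
  rewrite exchange_big big1//= => j _; rewrite -scaler_suml.
  suff -> : \sum_i c i * M i j = 0 by rewrite scale0r.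
  transitivity (t%:C * (v *m m) 0 j); last by rewrite vm mxE mulr0.
  by rewrite mxE mulr_sumr; apply: eq_bigr => i _; rewrite mxE [RHS]mulrA.
have f1 : Hmix_norm f <= 1.
  by rewrite /Hmix_norm fE mix_sqnorm_basis_comb//= cW sqrtr1.
(* As [A f = 0], the error at [f] is its L2 norm, and [B^2 = B^2 * 1] is at most the sum of the
   [|c_i|^2] because [B^2] times each weight on [S] is at most 1. *)
apply: (@le_trans _ _ (L2_norm (Hmix_embedding f - A f))%:E); last first.
  by apply: ereal_sup_ubound; exists f.
rewrite Af subr0 /Hmix_embedding fE lee_fin L2_normE.
rewrite -[leLHS]ger0_norm// -sqrtr_sqr; apply: ler_wsqrtr.
rewrite L2_sqnorm_basis_comb// -[leLHS]mulr1 -cW mulr_sumr; apply: ler_sum => i _.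
by rewrite mulrCA ler_piMr ?sqr_ge0// hB// mem_tnth.
Qed.

End approximation_bounds.

(** * From radii to rates *)

Section radii.
Variable R : realType.
Implicit Types (s r : R) (d n : nat).

(** Weights are integers: outside the cross they are at least [Num.truncn r + 1], which exceeds
    [r]. *)
Lemma hcross_radius_lt d (k : d.-tuple int) s r : 0 <= r -> 0 <= s ->
  k \notin hcross d (Num.truncn r) -> r `^ s <= (hweight k)%:R `^ s.
Proof.
move=> r0 s0; rewrite mem_hcross -ltnNge => hk.
apply: ge0_ler_powR => //; rewrite ?nnegrE//.
have /andP[_ /ltW rM] := truncn_itv r0.
by apply: le_trans rM _; rewrite ler_nat.
Qed.

Lemma hcross_radius_ge d (k : d.-tuple int) s r M : 0 <= s -> M%:R <= r ->
  k \in hcross d M -> (hweight k)%:R `^ s <= r `^ s.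
Proof.
move=> s0 Mr; rewrite mem_hcross => hk.
have hr : (hweight k)%:R <= r by apply: le_trans Mr; rewrite ler_nat.
by apply: ge0_ler_powR; rewrite ?nnegrE// (le_trans _ hr).
Qed.

Lemma upper_radius_gt0 d n : (1 < n)%N -> 0 < upper_radius R d n.
Proof.
move=> n1; have y0 : 0 < ln n%:R :> R by rewrite ln_gt0// ltr1n.
have n0 : (0 < n)%N by exact: ltnW.
by rewrite divr_gt0 ?mulr_gt0 ?exprn_gt0 ?ltr0n ?fact_gt0.
Qed.

Lemma lower_radius_gt0 d n : (1 < n)%N -> 0 < lower_radius R d n.
Proof.
move=> n1; have y0 : 0 < ln n%:R :> R by rewrite ln_gt0// ltr1n.
have n0 : (0 < n)%N by exact: ltnW.
have D0 : 0 < 2 + ln 12 :> R by have := ln12_ge2 R; lra.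
by rewrite divr_gt0 ?mulr_gt0 ?exprn_gt0 ?ltr0n ?fact_gt0.
Qed.

(** The cases [c = 1] and [c = 2] give the constants [3^d] and [6^d] of the upper bounds; in
    [lower_rate] they give [2^d] and [4^d]. *)
Lemma upper_rate d n s (c : R) : (1 < n)%N -> 0 <= c ->
  ((c * 3) ^+ d.+1 / d`!%:R) `^ s * (ln n%:R `^ (d%:R * s) / n%:R `^ s) =
  (c ^+ d.+1 / upper_radius R d n) `^ s.
Proof.
move=> n1 c0; have y0 : 0 < ln n%:R :> R by rewrite ln_gt0// ltr1n.
have n0 : 0 < n%:R :> R by rewrite ltr0n ltnW.
have f0 : 0 < d`!%:R :> R by rewrite ltr0n fact_gt0.
rewrite powR_rate ?(ltW y0)//; last by rewrite divr_ge0 ?exprn_ge0 ?mulr_ge0.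
congr (_ `^ _); rewrite /upper_radius exprMn.
have t0 : 0 < 3 ^+ d.+1 :> R by rewrite exprn_gt0.
have yd0 : 0 < ln n%:R ^+ d :> R by rewrite exprn_gt0.
move: (3 ^+ d.+1) t0 (ln n%:R ^+ d) yd0 (c ^+ d.+1) => a a0 b b0 e.
by field; rewrite !gt_eqF.
Qed.

Lemma lower_rate d n s (c : R) : (1 < n)%N -> 0 <= c ->
  ((3 * (c * 2) ^+ d.+1) / (d.+1`!%:R * (2 + ln 12) ^+ d.+1)) `^ s *
    (ln n%:R `^ (d%:R * s) / n%:R `^ s) =
  (c ^+ d.+1 / lower_radius R d n) `^ s.
Proof.
move=> n1 c0; have y0 : 0 < ln n%:R :> R by rewrite ln_gt0// ltr1n.
have n0 : 0 < n%:R :> R by rewrite ltr0n ltnW.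
have f0 : 0 < d.+1`!%:R :> R by rewrite ltr0n fact_gt0.
have D0 : 0 < 2 + ln 12 :> R by have := ln12_ge2 R; lra.
have Dd0 : 0 < (2 + ln 12) ^+ d.+1 :> R by rewrite exprn_gt0.
rewrite powR_rate ?(ltW y0)//; last first.
  by apply: divr_ge0; apply: mulr_ge0; rewrite ?(ltW Dd0)// exprn_ge0// mulr_ge0.
congr (_ `^ _); rewrite /lower_radius exprMn.
have t0 : 0 < 2 ^+ d.+1 :> R by rewrite exprn_gt0.
have yd0 : 0 < ln n%:R ^+ d :> R by rewrite exprn_gt0.
move: (2 ^+ d.+1) t0 (ln n%:R ^+ d) yd0 (c ^+ d.+1) ((2 + ln 12) ^+ d.+1) Dd0.
by move=> a a0 b b0 e D' D'0; field; rewrite !gt_eqF.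
Qed.

End radii.

Theorem theorem4p18 (R : realType) (d n : nat) (hd : (0 < d)%N) (hn : (0 < n)%N) :
  (forall s : R, 1 / 2 < s ->
    ((27 ^ d <= n)%N ->
      (mix_approx_number d s n <=
        (2 `^ (- (d%:R / 2)) * (6 ^+ d / (d.-1)`!%:R) `^ s *
         (ln n%:R `^ (d.-1%:R * s) / n%:R `^ s))%:E)%E) /\
    ((12 * expR 1 ^+ 2) ^+ d < n%:R :> R ->
      ((((3 * 2 ^+ d) / (d`!%:R * (2 + ln 12) ^+ d)) `^ s *
         (ln n%:R `^ (d.-1%:R * s) / n%:R `^ s))%:E
        <= mix_approx_number d s n)%E)) /\
  (forall s : R, 0 < s -> s <= 1 / 2 ->
    ((27 ^ d <= n)%N ->
      (mix_approx_number d s n <=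
        ((3 ^+ d / (d.-1)`!%:R) `^ s *
         (ln n%:R `^ (d.-1%:R * s) / n%:R `^ s))%:E)%E) /\
    ((12 * expR 1 ^+ 2) ^+ d < n%:R :> R ->
      ((2 `^ (- (d%:R / 2)) *
         ((3 * 4 ^+ d) / (d`!%:R * (2 + ln 12) ^+ d)) `^ s *
         (ln n%:R `^ (d.-1%:R * s) / n%:R `^ s))%:E
        <= mix_approx_number d s n)%E)).
Proof.
case: d hd => // d _ /=.
have n1_of_upper : (27 ^ d.+1 <= n)%N -> (1 < n)%N.
  by apply: leq_trans; rewrite -[1%N](exp1n d.+1) ltn_exp2r.
have n1_of_lower : (12 * expR 1 ^+ 2) ^+ d.+1 < n%:R :> R -> (1 < n)%N.
  move=> h; rewrite -(ltr_nat R); apply: le_lt_trans h.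
  apply: exprn_ege1; have : 1 <= expR 1 ^+ 2 :> R.
    by apply: exprn_ege1; rewrite -[leLHS]expR0 ler_expR.
  lra.
have upper_set (S := fun r : R => hcross d.+1 (Num.truncn r)) :
    (27 ^ d.+1 <= n)%N -> (size (S (upper_radius R d n)) < n)%N.
  move=> h; apply: (@size_hcross_upper R) => //.
  by have /andP[] := truncn_itv (ltW (upper_radius_gt0 R d (n1_of_upper h))).
have rp0 r s : 0 < r -> 0 < r `^ (2 * s) :> R by exact: powR_gt0.
split=> s.
- move=> s2; have s0 : 0 <= 2 * s by lra.
  split=> [h|h].
    have n1 := n1_of_upper h; have r0 := upper_radius_gt0 R d n1.
    have := upper_rate d s n1 (ler0n R 2); rewrite -natrM => e.
    rewrite -mulrA e; apply: mix_approx_number_le (uniq_hcross _ _) (upper_set h) _ _.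
      by rewrite mulr_ge0 ?powR_ge0.
    move=> k /(hcross_radius_lt (ltW r0) s0) rk.
    (* The power of 2 in the square of the bound is exactly the loss in [hweight_le_mix_weightX]. *)
    rewrite two_rate_sqr// mulrAC ler_pdivlMr ?rp0// mul1r.
    by apply: le_trans rk _; apply: hweight_le_mix_weightX; lra.
  have n1 := n1_of_lower h; have r0 := lower_radius_gt0 R d n1.
  have [M Mr nM] := size_hcross_lower h.
  have := lower_rate d s n1 (@ler01 R); rewrite mul1r expr1n => ->.
  apply: mix_approx_number_ge (uniq_hcross _ _) nM (powR_ge0 _ _) _.
  move=> k /(hcross_radius_ge s0 Mr) kr.
  rewrite powR_sqr div1r powRV// mulrC ler_pdivrMr ?rp0// mul1r.
  by apply: le_trans kr; apply: mix_weight_le_hweight; lra.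
- move=> s0' s2; have s0 : 0 <= 2 * s by lra.
  split=> [h|h].
    have n1 := n1_of_upper h; have r0 := upper_radius_gt0 R d n1.
    have := upper_rate d s n1 (@ler01 R); rewrite mul1r expr1n => ->.
    apply: mix_approx_number_le (uniq_hcross _ _) (upper_set h) (powR_ge0 _ _) _.
    move=> k /(hcross_radius_lt (ltW r0) s0) rk.
    rewrite powR_sqr div1r powRV// mulrC ler_pdivlMr ?rp0// mul1r.
    by apply: le_trans rk _; exact: hweight_le_mix_weight.
  have n1 := n1_of_lower h; have r0 := lower_radius_gt0 R d n1.
  have [M Mr nM] := size_hcross_lower h.
  have := lower_rate d s n1 (ler0n R 2); rewrite -natrM => e.
  rewrite -mulrA e; apply: mix_approx_number_ge (uniq_hcross _ _) nM _ _.
    by rewrite mulr_ge0 ?powR_ge0.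
  move=> k /(hcross_radius_ge s0 Mr) kr.
  rewrite two_rate_sqr// mulrAC ler_pdivrMr ?rp0// mul1r; apply: le_trans kr.
  (* The loss [2 ^ ((1 - 2 s) d)] in the weight is cancelled by the power of 2 in the square of the
     bound. *)
  apply: (@le_trans _ _ (2 `^ ((2 * s - 1) * d.+1%:R) *
      (2 `^ ((1 - 2 * s) * d.+1%:R) * (hweight k)%:R `^ (2 * s)))).
    by rewrite ler_wpM2l ?powR_ge0//; exact: mix_weight_le_hweightX.
  rewrite mulrA -powRD ?pnatr_eq0 ?implybT//.
  by rewrite (_ : _ + _ = 0) ?powRr0 ?mul1r//; ring.
Qed.
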